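(* Consider the independent stationary (IID) model set-up, fix $\alpha\ge0$, and assume that the prior $\pi$ on $\Theta$ does not depend on $n$ and is information dense at $g$ with respect to $\mathcal F_\alpha=\{\widetilde q^{(\alpha)}(\cdot|\theta):\theta\in\Theta\}$. Let $A_n\subset\Theta$ be any sequence of measurable sets. Then $\pi_n^{(\alpha)}(A_n^c|\underline X_n)$ is exponentially small with $P$-probability tending to one, i.e. there is $r>0$ with $\lim_{n\to\infty}P(\pi_n^{(\alpha)}(A_n^c|\underline X_n)<e^{-nr})=1$, if and only if there exist constants $r_1,r_2>0$ and sets $B_n,C_n\in\mathcal B_\Theta$ such that (A1) $A_n\cup B_n\cup C_n=\Theta$ for each $n\ge1$; (A2) $\widetilde\pi_n^{(\alpha)}(B_n)=M_n^{(\alpha)}(\chi^n,B_n)/M_n^{(\alpha)}(\chi^n,\Theta)\le e^{-nr_1}$ for each $n\ge1$; (A3) there exist measurable $S_n\subseteq\chi^n$ with $\lim_{n\to\infty}G^n(S_n)=0$ and $\sup_{\theta\in C_n}\dfrac{Q_n^{(\alpha)}(S_n^c|\theta)}{Q_n^{(\alpha)}(\chi^n|\theta)}\le e^{-nr_2}$.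
   Context: IID set-up. On a true probability space $(\Omega,\mathcal B_\Omega,P)$, $X_1,X_2,\dots$ are i.i.d. with values in a measurable space $(\chi,\mathcal B)$, with law $G$ having density $g$ with respect to a $\sigma$-finite measure $\lambda$; $\underline X_n=(X_1,\dots,X_n)$ and $G^n$ is its law on $\chi^n$. The model is $\{F_\theta:\theta\in\Theta\subseteq\mathbb R^p\}$ with densities $f_\theta$ with respect to $\lambda$; $\Theta$ has $\sigma$-field $\mathcal B_\Theta$ and prior measure $\pi$ with $\pi(\Theta)\le1$. For $\alpha>0$ let $q_\theta^{(\alpha)}(y)=\frac1\alpha(f_\theta^\alpha(y)-1)-\frac1{1+\alpha}\int f_\theta^{1+\alpha}d\lambda$, and $q_\theta^{(0)}(y)=\log f_\theta(y)-1$; $q_n^{(\alpha)}(\underline x_n|\theta)=\sum_{i=1}^nq_\theta^{(\alpha)}(x_i)$. Put $Q^{(\alpha)}(S|\theta)=\int_S\exp(q_\theta^{(\alpha)}(y))\lambda(dy)$ for $S\in\mathcal B$, $Q_n^{(\alpha)}(S_n|\theta)=\int_{S_n}\exp(q_n^{(\alpha)}(\underline x_n|\theta))\lambda^n(d\underline x_n)$ for measurable $S_n\subseteq\chi^n$ (so $Q_n^{(\alpha)}(\chi^n|\theta)=Q^{(\alpha)}(\chi|\theta)^n$), and $M_n^{(\alpha)}(S_n,A)=\int_AQ_n^{(\alpha)}(S_n|\theta)\pi(d\theta)$. It is assumed that $0<M_n^{(\alpha)}(\chi^n,\Theta)<\infty$ and $0<Q^{(\alpha)}(\chi|\theta)<\infty$.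 The $R^{(\alpha)}$-posterior is $\pi_n^{(\alpha)}(A|\underline x_n)=\int_A\exp(q_n^{(\alpha)}(\underline x_n|\theta))\pi(d\theta)\big/\int_\Theta\exp(q_n^{(\alpha)}(\underline x_n|\theta))\pi(d\theta)$. The $\alpha$-modified density is $\widetilde q^{(\alpha)}(y|\theta)=\exp(q_\theta^{(\alpha)}(y))/Q^{(\alpha)}(\chi|\theta)$ and the $\alpha$-modified prior is $\widetilde\pi_n^{(\alpha)}(d\theta)=Q_n^{(\alpha)}(\chi^n|\theta)\pi(d\theta)/M_n^{(\alpha)}(\chi^n,\Theta)$. With $KLD(f_1,f_2)=\int f_1\log(f_1/f_2)d\lambda$, the prior is information dense at $g$ (equivalently at $G$) with respect to $\mathcal F_\alpha$ if there is a finite measure $\widetilde\pi$ on $\Theta$ such that $\liminf_{n\to\infty}e^{nr}\frac{d\widetilde\pi_n^{(\alpha)}}{d\widetilde\pi}(\theta)\ge1$ for all $r>0$, $\theta\in\Theta$, and $\widetilde\pi(\{\theta:KLD(g,\widetilde q^{(\alpha)}(\cdot|\theta))<\epsilon\})>0$ for all $\epsilon>0$. *)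

(* Defs.v *)
From HB Require Import structures.
From mathcomp Require Import all_boot all_order all_algebra finmap.
From mathcomp Require Import all_classical all_reals all_analysis.
From mathcomp Require Import measurable_realfun.

Set Implicit Arguments.
Unset Strict Implicit.
Unset Printing Implicit Defensive.

Import Order.TTheory GRing.Theory Num.Theory.
Import numFieldNormedType.Exports.

Local Open Scope classical_set_scope.
Local Open Scope ring_scope.
Local Open Scope ereal_scope.

Section power_measure.
Context {d} {T : measurableType d} {R : realType}.
Variable lam : {sigma_finite_measure set T -> \bar R}.

Section step.
Variables (n : nat) (m : {sigma_finite_measure set (n.-tuple T) -> \bar R}).

Definition tcons (z : T * n.-tuple T) : n.+1.-tuple T := [tuple of z.1 :: z.2].

Lemma measurable_tcons : measurable_fun setT tcons.
Proof. exact: measurable_cons. Qed.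

Definition power_step := pushforward (lam \x m) tcons.

Let power_step0 : power_step set0 = 0.
Proof. by rewrite /power_step /pushforward preimage_set0 measure0. Qed.

Let power_step_ge0 A : 0 <= power_step A.
Proof. by rewrite /power_step /pushforward. Qed.

Let power_step_sigma_additive : semi_sigma_additive power_step.
Proof.
move=> F mF tF mUF; rewrite /power_step /pushforward preimage_bigcup.
apply: measure_semi_sigma_additive.
- by move=> k; rewrite -[X in measurable X]setTI; exact: measurable_tcons.
- apply/trivIsetP => /= i j _ _ ij; rewrite -preimage_setI.
  by move/trivIsetP : tF => /(_ _ _ _ _ ij) ->//; rewrite preimage_set0.
- rewrite -preimage_bigcup -[X in measurable X]setTI.
  exact: measurable_tcons.
Qed.

HB.instance Definition _ := isMeasure.Build _ _ _ power_step
  power_step0 power_step_ge0 power_step_sigma_additive.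

Let power_step_sigma_finite : sigma_finite setT power_step.
Proof.
have [F [TF ndF Foo]] := (sigma_finiteP _ _).1 (sigma_finiteT lam).
have [G [TG ndG Goo]] := (sigma_finiteP _ _).1 (sigma_finiteT m).
pose split_tuple (x : n.+1.-tuple T) := (thead x, [tuple of behead x]).
have cK : cancel tcons split_tuple.
  case=> x t; rewrite /split_tuple /tcons /= theadE.
  by congr pair; apply/val_inj.
exists (fun k => split_tuple @^-1` (F k `*` G k)).
  rewrite -preimage_bigcup -[LHS](preimage_setT split_tuple); congr (_ @^-1` _).
  apply/esym; rewrite -subTset => -[x t] _.
  have [i _ Fx] : (\bigcup_i F i) x by rewrite -TF.
  have [j _ Gt] : (\bigcup_j G j) t by rewrite -TG.
  exists (maxn i j) => //; split => /=.
  - by move: Fx; exact/subsetPset/ndF/leq_maxl.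
  - by move: Gt; exact/subsetPset/ndG/leq_maxr.
move=> k; have [mF Fk] := Foo k; have [mG Gk] := Goo k.
have mFG : measurable (F k `*` G k) by exact: measurableX.
split.
  rewrite -[X in measurable X]setTI.
  suff : measurable_fun setT split_tuple by apply.
  apply/measurable_fun_pairP; split; first exact: measurable_tnth.
  exact: measurable_behead.
rewrite /power_step /pushforward -comp_preimage.
rewrite (_ : _ \o _ = id) ?preimage_id; last exact/funext.
by rewrite product_measure1E// lte_mul_pinfty// ge0_fin_numE.
Qed.

HB.instance Definition _ :=
  Measure_isSigmaFinite.Build _ _ _ power_step power_step_sigma_finite.

End step.

(* The n-fold product lam^n, on n-tuples with the product sigma-field. *)
Fixpoint power_measure n : {sigma_finite_measure set (n.-tuple T) -> \bar R} :=
  match n with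
  | 0 => dirac [tuple]
  | n'.+1 => power_step (power_measure n')
  end.

End power_measure.

Section iid.
Context {dO d} {Omega : measurableType dO} {T : measurableType d}.
Context {R : realType}.
Variables (P : probability Omega R) (X : nat -> {RV P >-> T}).

Definition mutually_independent : Prop :=
  forall (J : {fset nat}) (A : nat -> set T),
    (forall i, measurable (A i)) ->
    P (\bigcap_(i in [set` J]) (X i @^-1` A i)) =
    \prod_(i <- J) P (X i @^-1` A i).

(* X i is the observation usually numbered i.+1. *)
Definition sample (n : nat) (w : Omega) : n.-tuple T := [tuple X i w | i < n].

Definition sample_law (n : nat) : set (n.-tuple T) -> \bar R :=
  pushforward P (sample n).

End iid.

Definition is_density {d} {T : measurableType d} {R : realType}
    (lam : set T -> \bar R) (G : set T -> \bar R) (g : T -> R) : Prop :=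
  [/\ measurable_fun setT g, (forall y, (0 <= g y)%R) &
      forall A, measurable A -> G A = \int[lam]_(y in A) (g y)%:E].

(* The integrand is extended-real valued: it is 0 where f1 = 0 (since
   0 * -oo = 0) and +oo where f1 > 0 = f2 (since x / 0 = +oo for x > 0). *)
Definition KLD {d} {T : measurableType d} {R : realType} (lam : set T -> \bar R)
    (f1 f2 : T -> \bar R) : \bar R :=
  \int[lam]_y (f1 y * lne (f1 y / f2 y)).

Section robust_posterior.
Context {d dU} {T : measurableType d} {U : measurableType dU} {R : realType}.
(* The parameter set Theta is a subset of the carrier U; pi is only ever used
   on measurable subsets of Theta. *)
Variables (lam : {sigma_finite_measure set T -> \bar R}) (alpha : R).
Variables (f : U -> T -> R) (Theta : set U) (pi : set U -> \bar R).

(* Valued in \bar R because for alpha = 0 it is -oo where f = 0, so that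
   its exponential vanishes there; for alpha > 0 it is -oo when the integral
   of f ^ (1 + alpha) diverges. *)
Definition qscore (theta : U) (y : T) : \bar R :=
  if alpha == 0%R then lne (f theta y)%:E - 1
  else (alpha^-1 * (f theta y `^ alpha - 1))%:E
       - ((1 + alpha)^-1)%:E * \int[lam]_z (f theta z `^ (1 + alpha))%:E.

Definition qscore_n n (theta : U) (x : n.-tuple T) : \bar R :=
  \sum_(i < n) qscore theta (tnth x i).

Definition Q (S : set T) (theta : U) : \bar R :=
  \int[lam]_(y in S) expeR (qscore theta y).

Definition Qn n (S : set (n.-tuple T)) (theta : U) : \bar R :=
  \int[power_measure lam n]_(x in S) expeR (qscore_n theta x).
#[local] Arguments Qn : clear implicits.

Definition Mn n (S : set (n.-tuple T)) (A : set U) : \bar R :=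
  \int[pi]_(theta in A) Qn n S theta.
#[local] Arguments Mn : clear implicits.

Definition posterior n (A : set U) (x : n.-tuple T) : \bar R :=
  (\int[pi]_(theta in A) expeR (qscore_n theta x))
  / (\int[pi]_(theta in Theta) expeR (qscore_n theta x)).

Definition modified_density (theta : U) (y : T) : \bar R :=
  expeR (qscore theta y) / Q setT theta.

Definition modified_prior n (A : set U) : \bar R :=
  Mn n setT A / Mn n setT Theta.

(* h is a version of the Radon-Nikodym derivative d nu / d mu on Theta. *)
Definition is_derivative_version (nu mu : set U -> \bar R) (h : U -> \bar R) :
    Prop :=
  [/\ measurable_fun Theta h, (forall theta, Theta theta -> 0 <= h theta) &
      forall A, measurable A -> A `<=` Theta ->
        nu A = \int[mu]_(theta in A) h theta].

(* A Radon-Nikodym derivative is only defined almost everywhere, so a condition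
   on its values at every theta is a condition on some choice of versions. *)
Definition information_dense (g : T -> R) : Prop :=
  exists pitilde : {finite_measure set U -> \bar R},
    (exists h : nat -> U -> \bar R,
       (forall n, (0 < n)%N ->
          is_derivative_version (modified_prior n) pitilde (h n)) /\
       (forall (r : R) theta, (0 < r)%R -> Theta theta ->
          1 <= limn_einf (fun n => (expR (n%:R * r))%:E * h n theta))) /\
    (forall e : R, (0 < e)%R ->
       0 < pitilde [set theta | Theta theta /\
             KLD lam (EFin \o g) (modified_density theta) < e%:E]).

End robust_posterior.

Arguments Qn {d dU T U R} lam alpha f n S theta.
Arguments Mn {d dU T U R} lam alpha f pi n S A.

(* Main.v *)
Require Import Defs.
From HB Require Import structures.
From mathcomp Require Import all_boot all_order all_algebra finmap.
From mathcomp Require Import all_classical all_reals all_analysis.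
From mathcomp Require Import measurable_realfun.
From mathcomp Require Import ring lra.

Set Implicit Arguments.
Unset Strict Implicit.
Unset Printing Implicit Defensive.

Import Order.TTheory GRing.Theory Num.Theory.
Import numFieldNormedType.Exports.

Local Open Scope classical_set_scope.
Local Open Scope ring_scope.
Local Open Scope ereal_scope.

(** If S_n collects the samples where the posterior mass of the complement of
    A_n is at least exp(-nr), then Tonelli gives
    M_n(~S_n, Theta \ A_n) <= exp(-nr) M_n(chi^n, Theta); by Markov, the
    parameters with Q_n(~S_n|theta) > exp(-nr/2) Q_n(chi^n|theta) have modified
    prior mass at most exp(-nr/2): they form B_n, and C_n is the rest.

    Conversely, Markov's inequality under G^n bounds the numerator of the
    posterior on B_n, and on C_n off S_n, by exp(-nt) g^n M_n, except on a set
    of G^n-probability at most exp(-nt).  It remains to bound the denominator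
    below by exp(-nr) g^n M_n in probability, for every r > 0.  On the set K of
    parameters whose relative entropy from g is below eps, Markov's inequality
    applied to the relative entropy of n-fold products, which is at most n eps,
    bounds the probability that the modified likelihood is less than
    exp(-nr) g^n; it does not tend to 0, but its limsup is at most eps / r and
    eps is arbitrary, so that no law of large numbers is needed.  Averaging over
    K with respect to the dominating measure transfers the bound to the mixture. *)

(** * Tonelli and product measures *)

Section measurable_comparison.
Context d (T : measurableType d) (R : realType).

Lemma measurable_set_lte (f h : T -> \bar R) :
    measurable_fun setT f -> measurable_fun setT h ->
  measurable [set x | f x < h x].
Proof. by move=> mf mh; rewrite -[X in measurable X]setTI; exact: measurable_lte. Qed.

Lemma measurable_set_ltr (f h : T -> R) :
    measurable_fun setT f -> measurable_fun setT h ->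
  measurable [set x | (f x < h x)%R].
Proof.
move=> mf mh; rewrite (_ : [set x | _] = [set x | (f x)%:E < (h x)%:E]).
  by apply: measurable_set_lte; exact/measurable_EFinP.
by apply/seteqP; split=> x /=; rewrite lte_fin.
Qed.

End measurable_comparison.

Section tonelli.
Context d1 d2 (T1 : measurableType d1) (T2 : measurableType d2) (R : realType).
Variables (m1 : {sigma_finite_measure set T1 -> \bar R}).
Variables (m2 : {sigma_finite_measure set T2 -> \bar R}).
Variable f : T1 * T2 -> \bar R.
Hypotheses (mf : measurable_fun setT f) (f0 : forall z, 0 <= f z).

Let patch_f (D : set T2) x y :
  ((fun y => f (x, y)) \_ D) y = (f \_ (setT `*` D)) (x, y).
Proof.
by rewrite !patchE; congr (if _ then _ else _); apply/idP/idP; rewrite !inE//= => -[].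
Qed.

(** Extending the integrand by zero off the rectangle [D1 * D2] reduces this to Tonelli on the whole
    product; each iterated integral is then recovered by cases on membership. *)
Lemma tonelli_within (D1 : set T1) (D2 : set T2) :
    measurable D1 -> measurable D2 ->
  \int[m1]_(x in D1) \int[m2]_(y in D2) f (x, y) =
  \int[m2]_(y in D2) \int[m1]_(x in D1) f (x, y).
Proof.
move=> mD1 mD2; pose F := f \_ (D1 `*` D2).
have FE x y : F (x, y) = if (x \in D1) && (y \in D2) then f (x, y) else 0.
  by rewrite /F patchE in_setX.
have F0 z : 0 <= F z by apply: erestrict_ge0 => ? _.
have mF : measurable_fun setT F.
  apply/(measurable_restrictT _ _).1; first exact: measurableX.
  exact: measurable_funS mf.
have := @fubini_tonelli _ _ _ _ _ m1 m2 _ mF F0.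
congr (_ = _); rewrite [RHS]integral_mkcond; apply: eq_integral => x _;
  rewrite patchE; case: ifPn => xD.
- rewrite [RHS]integral_mkcond; apply: eq_integral => y _.
  by rewrite FE xD/= patchE.
- by rewrite integral0_eq// => y _; rewrite FE (negbTE xD).
- rewrite [RHS]integral_mkcond; apply: eq_integral => y _.
  by rewrite FE xD/= patchE andbT.
- by rewrite integral0_eq// => y _; rewrite FE (negbTE xD) andbF.
Qed.

Lemma measurable_integral2 (D : set T2) : measurable D ->
  measurable_fun setT (fun x => \int[m2]_(y in D) f (x, y)).
Proof.
move=> mD; under eq_fun do rewrite integral_mkcond.
rewrite (_ : (fun _ => _) = fubini_F m2 (f \_ (setT `*` D))); last first.
  by apply/funext => x; apply: eq_integral => y _; exact: patch_f.
apply: measurable_fun_fubini_tonelli_F.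
  apply/(measurable_restrictT _ _).1; first exact: measurableX.
  exact: measurable_funS mf.
by move=> z; apply: erestrict_ge0.
Qed.

End tonelli.

Section power_measure_theory.
Context {d} {T : measurableType d} {R : realType}.
Variable lam : {sigma_finite_measure set T -> \bar R}.

Lemma tnth_tcons0 n (z : T * n.-tuple T) : tnth (tcons z) ord0 = z.1.
Proof. by []. Qed.

Lemma tnth_tcons_lift n (z : T * n.-tuple T) (i : 'I_n) :
  tnth (tcons z) (lift ord0 i) = tnth z.2 i.
Proof. exact: tnthS. Qed.

Lemma ge0_integral_power0 (phi : 0.-tuple T -> \bar R) :
    measurable_fun setT phi ->
  \int[power_measure lam 0]_x phi x = phi [tuple].
Proof. by move=> mphi; rewrite integral_dirac// diracT mul1e. Qed.

(** The measure on [n.+1]-tuples is the image of a product under [tcons], so a change of variables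
    followed by Tonelli peels off the first coordinate. This is the induction step for everything
    about [power_measure]. *)
Lemma ge0_integral_powerS n (phi : n.+1.-tuple T -> \bar R) :
    measurable_fun setT phi -> (forall x, 0 <= phi x) ->
  \int[power_measure lam n.+1]_x phi x =
  \int[lam]_y \int[power_measure lam n]_x phi (tcons (y, x)).
Proof.
move=> mphi phi0.
transitivity (\int[lam \x power_measure lam n]_z phi (tcons z)).
  rewrite [LHS](@ge0_integral_pushforward _ _ _ _ _ _ (measurable_tcons (T := T) (n := n))
    (lam \x power_measure lam n) setT)//.
rewrite fubini_tonelli1//.
by apply: measurableT_comp => //; exact: measurable_tcons.
Qed.

Lemma measurable_tuple_prod n (phi : nat -> T -> R) :
    (forall i, measurable_fun setT (phi i)) ->
  measurable_fun setT (fun x : n.-tuple T => (\prod_(i < n) phi i (tnth x i))%R).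
Proof.
move=> mphi; apply: measurable_prod => i _.
apply: (measurableT_comp (mphi i)); exact: measurable_tnth.
Qed.

(** The factors are indexed by [nat] and may differ between coordinates, so that the induction
    hypothesis applies to the shifted family [fun i => phi i.+1]. *)
Lemma ge0_integral_power_prod n (phi : nat -> T -> R) :
    (forall i, measurable_fun setT (phi i)) -> (forall i y, (0 <= phi i y)%R) ->
  \int[power_measure lam n]_x (\prod_(i < n) phi i (tnth x i))%:E =
  \prod_(i < n) \int[lam]_y (phi i y)%:E.
Proof.
elim: n phi => [|n IH] phi mphi phi0.
  rewrite ge0_integral_power0 ?big_ord0//.
  by apply/measurable_EFinP; exact: measurable_tuple_prod.
rewrite ge0_integral_powerS//; last 2 first.
- by apply/measurable_EFinP; exact: measurable_tuple_prod.
- by move=> x; rewrite lee_fin prodr_ge0.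
transitivity ((\int[lam]_y (phi 0%N y)%:E) *
    \int[power_measure lam n]_x (\prod_(i < n) phi i.+1 (tnth x i))%:E); last first.
  by rewrite big_ord_recl (IH (fun i => phi i.+1)).
set I := \int[power_measure lam n]_x _.
have I0 : 0 <= I by apply: integral_ge0 => x _; rewrite lee_fin prodr_ge0.
transitivity (\int[lam]_y ((phi 0%N y)%:E * I)).
  apply: eq_integral => y _; rewrite -ge0_integralZl_EFin//; last 2 first.
  - by move=> x _; rewrite lee_fin prodr_ge0.
  - apply/measurable_EFinP.
    exact: (measurable_tuple_prod (phi := fun i => phi i.+1)).
  apply: eq_integral => x _; rewrite big_ord_recl tnth_tcons0 EFinM.
  by under eq_bigr do rewrite tnth_tcons_lift.
rewrite ge0_integralZr//; first exact/measurable_EFinP.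
by move=> y _; rewrite lee_fin.
Qed.

End power_measure_theory.

(** * The law of the sample *)

Section density_measure.
Context d (T : measurableType d) (R : realType).
Variables (mu : {measure set T -> \bar R}) (phi : T -> \bar R).
Hypotheses (mphi : measurable_fun setT phi) (phi0 : forall x, 0 <= phi x).

(** The proofs of measurability and nonnegativity are arguments so that the measure structure
    declared below, which rests on them, can be attached to the function. *)
Definition density_measure of measurable_fun setT phi & (forall x, 0 <= phi x) :=
  fun A => \int[mu]_(x in A) phi x.
Local Notation nu := (density_measure mphi phi0).

Let nu0 : nu set0 = 0. Proof. exact: integral_set0. Qed.
Let nu_ge0 A : 0 <= nu A. Proof. by apply: integral_ge0 => x _. Qed.
Let nu_sigma_additive : semi_sigma_additive nu.
Proof.
move=> F mF tF mUF; rewrite /density_measure ge0_integral_bigcup//.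
- by apply: is_cvg_nneseries => n _ _; exact: integral_ge0.
- by apply: measurable_funS mphi.
Qed.
HB.instance Definition _ := isMeasure.Build _ _ _ nu nu0 nu_ge0 nu_sigma_additive.
End density_measure.

Section rectangles.
Context {d} {T : measurableType d}.

Definition rectangle n (A : nat -> set T) : set (n.-tuple T) :=
  [set x | forall i : 'I_n, A i (tnth x i)].
#[local] Arguments rectangle : clear implicits.

Definition rectangles n : set (set (n.-tuple T)) :=
  [set rectangle n A | A in [set A | forall i, measurable (A i)]].
#[local] Arguments rectangles : clear implicits.

Lemma measurable_rectangle n (A : nat -> set T) :
  (forall i, measurable (A i)) -> measurable (rectangle n A).
Proof.
move=> mA; rewrite (_ : rectangle n A =
    \bigcap_(i in [set: 'I_n]) ((fun x => tnth x i) @^-1` A i)); last first.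
  by apply/seteqP; split=> [x xA i _|x xA i]; [exact: xA|exact: xA].
apply: fin_bigcap_measurable => // i _.
rewrite -[X in measurable X]setTI; exact: measurable_tnth.
Qed.

Lemma measurable_tuple_rectangles n :
  @measurable _ (n.-tuple T) = <<s rectangles n >>.
Proof.
apply/seteqP; split.
- apply: smallest_sub; first exact: smallest_sigma_algebra.
  rewrite -bigcup_seq => S [i _] [B mB <-]; rewrite setTI.
  apply: sub_sigma_algebra.
  (* A cylinder over coordinate [i] is the rectangle all of whose other sides are the whole
     space. *)
  exists (fun j : nat => if j == i :> nat then B else setT).
    by move=> j /=; case: ifP.
  apply/seteqP; split=> x.
    by move=> /(_ i); rewrite eqxx.
  move=> /= xB j; case: ifPn => // /eqP ji.
  by have -> : j = i by exact/val_inj.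
- apply: smallest_sub; first exact: sigma_algebra_measurable.
  by move=> _ [A mA <-]; exact: measurable_rectangle.
Qed.

Lemma rectangles_setI_closed n : setI_closed (rectangles n).
Proof.
move=> _ _ [A mA <-] [B mB <-]; exists (fun i => A i `&` B i).
  by move=> i; exact: measurableI.
apply/seteqP; split=> x.
  by move=> xAB; split=> i; have [] := xAB i.
by move=> [xA xB] i; split; [exact: xA|exact: xB].
Qed.

End rectangles.
Arguments rectangle {d T} n A.
Arguments rectangles {d T} n.

Section sample_law.
Context {dO d} {Omega : measurableType dO} {T : measurableType d}.
Context {R : realType}.
Variables (P : probability Omega R) (X : nat -> {RV P >-> T}).
Hypothesis Xindep : mutually_independent X.
Variables (lam : {sigma_finite_measure set T -> \bar R}) (G : probability T R).
Hypothesis Xlaw : forall i (S : set T), measurable S -> distribution P (X i) S = G S.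
Variable g : T -> R.
Hypothesis Gg : is_density lam G g.

Lemma measurable_sample n : measurable_fun setT (sample X n).
Proof.
apply/measurable_fun_tnthP => i; rewrite (_ : _ \o _ = X i)//.
by apply/funext => w; rewrite /= tnth_mktuple.
Qed.

Lemma sample_law_rectangle n (A : nat -> set T) : (forall i, measurable (A i)) ->
  P (sample X n @^-1` rectangle n A) = \prod_(i < n) G (A i).
Proof.
move=> mA; pose J := [fset i in iota 0 n]%fset.
have JE i : (i \in J) = (i < n)%N by rewrite !inE/= mem_iota.
rewrite (_ : _ @^-1` _ = \bigcap_(i in [set` J]) (X i @^-1` A i)); last first.
  apply/seteqP; split=> w.
    move=> wA i /=; rewrite JE => ltin.
    by have := wA (Ordinal ltin); rewrite tnth_mktuple.
  by move=> wA i; rewrite tnth_mktuple; apply: wA => /=; rewrite JE.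
rewrite Xindep// (perm_big (iota 0 n)); last first.
  apply: uniq_perm; [exact: fset_uniq|exact: iota_uniq|].
  by move=> i; rewrite JE mem_iota.
rewrite -[n in iota 0 n]subn0 -[LHS]/(\prod_(0 <= i < n) P (X i @^-1` A i)) big_mkord.
by apply: eq_bigr => i _; rewrite -(Xlaw i).
Qed.

(** The indicator of a rectangle is the product of the indicators of its sides, so the integrand
    factorises coordinate by coordinate. *)
Lemma integral_rectangle n (A : nat -> set T) : (forall i, measurable (A i)) ->
  \int[power_measure lam n]_(x in rectangle n A) (\prod_(i < n) g (tnth x i))%:E =
  \prod_(i < n) G (A i).
Proof.
case: Gg => mg g0 GE mA; pose phi i y := (g y * \1_(A i) y)%R.
have -> : \prod_(i < n) G (A i) = \prod_(i < n) \int[lam]_y (phi i y)%:E.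
  apply: eq_bigr => i _; rewrite GE// integral_mkcond; apply: eq_integral => y _.
  by rewrite patchE /phi indicE; case: ifPn; rewrite ?mulr1 ?mulr0.
rewrite -ge0_integral_power_prod; last 2 first.
- by move=> i; apply: measurable_funM => //.
- by move=> i y; rewrite mulr_ge0.
rewrite integral_mkcond; apply: eq_integral => x _.
rewrite patchE big_split/=; case: ifPn => xA.
  rewrite [X in (_ * X)%R]big1 ?mulr1// => i _.
  by rewrite indicE mem_set//; move: xA; rewrite inE; exact.
have [i xAi] : exists i : 'I_n, ~ A i (tnth x i).
  by apply/existsNP; apply: contraNnot xA; rewrite inE.
by rewrite [X in (_ * X)%R](bigD1 i)//= indicE memNset// mul0r mulr0.
Qed.

(** Uniqueness of measures: both sides are finite measures that agree on rectangles, and rectangles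
    are stable under intersection and generate the product sigma-field. This turns [P]-probabilities
    of sample events into integrals of the product density. *)
Lemma sample_lawE n (S : set (n.-tuple T)) : measurable S ->
  P (sample X n @^-1` S) =
  \int[power_measure lam n]_(x in S) (\prod_(i < n) g (tnth x i))%:E.
Proof.
move=> mS; have [mg g0 GE] := Gg.
have mgn : measurable_fun setT (fun x : n.-tuple T => (\prod_(i < n) g (tnth x i))%:E).
  by apply/measurable_EFinP; exact: (measurable_tuple_prod (phi := fun=> g)).
have gn0 x : 0 <= (\prod_(i < n) g (tnth x i))%:E by rewrite lee_fin prodr_ge0.
pose smp : {mfun Omega >-> n.-tuple T} :=
  HB.pack (sample X n) (isMeasurableFun.Build _ _ _ _ _ (@measurable_sample n)).
pose nu := density_measure (power_measure lam n) mgn gn0 :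
  {measure set (n.-tuple T) -> \bar R}.
apply: (measure_unique (rectangles n) (fun=> setT) _ _ _ _
  (distribution P smp) nu) => //.
- exact: measurable_tuple_rectangles.
- exact: rectangles_setI_closed.
- by exists (fun=> setT) => //; apply/seteqP; split.
- by rewrite bigcup_const//.
- move=> _ [A mA <-]; transitivity (\prod_(i < n) G (A i)).
    exact: sample_law_rectangle.
  exact/esym/integral_rectangle.
- by rewrite (le_lt_trans (probability_le1 _ _))// ltry.
Qed.

End sample_law.

(** * Relative entropy *)

Section klgap.
Context {R : realType}.
Implicit Types a b : R.

(* The integrand of the relative entropy, shifted by [b - a] to make it
   nonnegative; for densities the shift integrates to [0]. *)
Definition klgap a b : \bar R :=
  if b == 0%R then (if a == 0%R then 0 else +oo)
  else (a * (ln a - ln b) - a + b)%:E.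

Lemma klgap0l b : klgap 0 b = b%:E.
Proof. by rewrite /klgap; case: eqP => [->|_]; rewrite ?eqxx// mul0r subr0 add0r. Qed.

Lemma klgap0r a : (0 < a)%R -> klgap a 0 = +oo.
Proof. by move=> a0; rewrite /klgap eqxx gt_eqF. Qed.

Lemma klgap_EFin a b : (b != 0)%R ->
  klgap a b = (a * (ln a - ln b) - a + b)%:E.
Proof. by rewrite /klgap => /negbTE ->. Qed.

Lemma klgap_ge0 a b : (0 <= a)%R -> (0 <= b)%R -> 0 <= klgap a b.
Proof.
rewrite le_eqVlt => /predU1P[<- b0|a0]; first by rewrite klgap0l lee_fin.
rewrite le_eqVlt => /predU1P[<-|b0]; first by rewrite klgap0r.
rewrite klgap_EFin ?gt_eqF// lee_fin.
have := ler_wpM2l (ltW a0) (expR_ge1Dx (ln b - ln a)).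
have -> : (a * expR (ln b - ln a) = b)%R.
  by rewrite expRB !lnK ?posrE// mulrCA divff ?mulr1// gt_eqF.
lra.
Qed.

(** For positive [b] and [b'] the two sides are equal, because the logarithm of a product splits;
    when [b] or [b'] vanishes while [a] and [a'] do not, the right side is [+oo]. Terms that would
    be subtracted stand on the opposite side, which avoids differences of infinities. *)
Lemma klgap_mul a b a' b' :
    (0 <= a)%R -> (0 <= b)%R -> (0 <= a')%R -> (0 <= b')%R ->
  klgap (a * a') (b * b') + (a' * b)%:E + (a * b')%:E <=
  a'%:E * klgap a b + a%:E * klgap a' b' + (a * a')%:E + (b * b')%:E.
Proof.
rewrite le_eqVlt => /predU1P[<- b0 a'0 b'0|a0].
  by rewrite !mul0r !klgap0l mul0e !adde0 -!EFinM addeC.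
move=> b0; rewrite le_eqVlt => /predU1P[<- b'0|a'0 b'0].
  by rewrite !(mulr0, mul0r) !klgap0l mul0e add0e !adde0 -EFinM addeC.
have [b00|bN0] := eqVneq b 0%R.
  rewrite b00 [klgap a 0]klgap0r//.
  rewrite -[X in _ <= X]addeA -[X in _ <= X]addeA mulry gtr0_sg// mul1e addye ?leey//.
  rewrite gt_eqF// (@lt_le_trans _ _ 0)//; apply: adde_ge0.
    by rewrite mule_ge0 ?lee_fin ?(ltW a0)//; apply: klgap_ge0 => //; exact: ltW.
  by rewrite mul0r adde0 lee_fin mulr_ge0// ltW.
have [b'00|b'N0] := eqVneq b' 0%R.
  rewrite b'00 [klgap a' 0]klgap0r//.
  rewrite [a%:E * +oo]mulry gtr0_sg// mul1e addey; last first.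
    rewrite gt_eqF// (@lt_le_trans _ _ 0)//.
    by rewrite mule_ge0 ?lee_fin ?(ltW a'0)//; apply: klgap_ge0 => //; exact: ltW.
  exact: leey.
have bp : (0 < b)%R by rewrite lt_neqAle eq_sym bN0.
have b'p : (0 < b')%R by rewrite lt_neqAle eq_sym b'N0.
rewrite !klgap_EFin ?mulf_neq0// -!EFinM -!EFinD lee_fin !lnM ?posrE//; nra.
Qed.

(** The hypothesis says [ln a - ln b > s] when [b] is positive; the loss of [1] in [s - 1] comes
    from the shift by [- a] in [klgap]. *)
Lemma klgap_ge_log a b s : (0 <= b)%R -> (b < expR (- s) * a)%R ->
  ((s - 1) * a)%:E <= klgap a b.
Proof.
move=> b0 bsa; have a0 : (0 < a)%R.
  by rewrite -(pmulr_rgt0 _ (expR_gt0 (- s))) (le_lt_trans b0).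
move: b0; rewrite le_eqVlt => /predU1P[<-|b0].
  by rewrite klgap0r// leey.
rewrite klgap_EFin ?gt_eqF// lee_fin.
suff : (s <= ln a - ln b)%R by move=> h; nra.
have := bsa; rewrite -ltr_ln ?posrE ?mulr_gt0 ?expR_gt0// lnM ?posrE ?expR_gt0//.
by rewrite expRK; lra.
Qed.

(** Links [klgap] to the integrand of [KLD], including its conventions at [a = 0] and at
    [b = 0 < a]. *)
Lemma mul_lne_klgap a b : (0 <= a)%R -> (0 <= b)%R ->
  a%:E * lne (a%:E / b%:E) = klgap a b + (a - b)%:E.
Proof.
rewrite le_eqVlt => /predU1P[<- b0|a0].
  by rewrite mul0e klgap0l -EFinD addrC subrK.
rewrite le_eqVlt => /predU1P[<-|b0].
  by rewrite inve0 klgap0r// mulry gtr0_sg// mul1e /= mulry gtr0_sg// mul1e.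
rewrite klgap_EFin ?gt_eqF// inver gt_eqF// -EFinM lne_EFin ?divr_gt0//.
rewrite ln_div ?posrE// -EFinM -EFinD; congr (_%:E); ring.
Qed.

Lemma measurable_klgap d (T : measurableType d) (f h : T -> R) :
    measurable_fun setT f -> measurable_fun setT h ->
  measurable_fun setT (fun x => klgap (f x) (h x)).
Proof.
move=> mf mh; rewrite /klgap.
have meq0 (k : T -> R) : measurable_fun setT k ->
    measurable_fun setT (fun x => k x == 0%R).
  by move=> mk; apply: measurable_fun_eqr => //; exact: measurable_cst.
apply: measurable_fun_ifT; [exact: meq0| |].
  by apply: measurable_fun_ifT; [exact: meq0|exact: measurable_cst..].
apply/measurable_EFinP; apply: measurable_funD => //.
apply: measurable_funB => //; apply: measurable_funM => //.
by apply: measurable_funB; exact: measurableT_comp.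
Qed.

End klgap.

Section relative_entropy.
Context {d} {T : measurableType d} {R : realType}.
Variable lam : {sigma_finite_measure set T -> \bar R}.
Variables g q : T -> R.
Hypotheses (mg : measurable_fun setT g) (mq : measurable_fun setT q).
Hypotheses (g0 : forall y, (0 <= g y)%R) (q0 : forall y, (0 <= q y)%R).
Hypotheses (g1 : \int[lam]_y (g y)%:E = 1) (q1 : \int[lam]_y (q y)%:E = 1).

Let mk := measurable_klgap mg mq.
Let k0 y : 0 <= klgap (g y) (q y). Proof. exact: klgap_ge0. Qed.

(** The shift integrates to [1 - 1], but the entropy may be infinite, so linearity cannot be used
    directly. The negative part of the signed integrand is dominated by [q], hence has a finite
    integral that can be moved across the equation. *)
Lemma KLD_klgap : KLD lam (EFin \o g) (EFin \o q) = \int[lam]_y klgap (g y) (q y).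
Proof.
rewrite /KLD; pose phi y := klgap (g y) (q y) + (g y - q y)%:E.
have -> : \int[lam]_y ((EFin \o g) y * lne ((EFin \o g) y / (EFin \o q) y)) =
    \int[lam]_y phi y.
  by apply: eq_integral => y _; rewrite /= mul_lne_klgap.
have mphi : measurable_fun setT phi.
  apply: emeasurable_funD => //; apply/measurable_EFinP.
  exact: measurable_funB.
have mphip := measurable_funepos mphi; have mphin := measurable_funeneg mphi.
have phin_le y : phi^\- y <= (q y)%:E.
  rewrite funenegE /phi ge_max lee_fin q0 andbT.
  have := k0 y; case: (klgap (g y) (q y)) => [r| |]//.
    by rewrite -EFinD -EFinN !lee_fin => r0; have := g0 y; lra.
  by rewrite leNye.
have Nfin : \int[lam]_y phi^\- y \is a fin_num.
  rewrite ge0_fin_numE; last by apply: integral_ge0.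
  rewrite (@le_lt_trans _ _ 1) ?ltry// -q1; apply: ge0_le_integral => //.
  exact/measurable_EFinP.
(* An identity between sums of nonnegative functions: it can be integrated term by term, and
   subtraction is postponed until the integrals are known. *)
have key y : klgap (g y) (q y) + (g y)%:E + phi^\- y = phi^\+ y + (q y)%:E.
  have e : phi y = phi^\+ y - phi^\- y by exact: (congr1 (@^~ y) (funeposneg phi)).
  have nfin : phi^\- y \is a fin_num.
    by rewrite ge0_fin_numE// (le_lt_trans (phin_le y))// ltry.
  rewrite [phi^\+ y](_ : _ = phi y + phi^\- y); last by rewrite e subeK.
  rewrite /phi; rewrite -(fineK nfin); move: (k0 y).
  by case: (klgap _ _) => [r| |]// _; rewrite -!EFinD; congr (_%:E); ring.
have : \int[lam]_y (klgap (g y) (q y) + (g y)%:E + phi^\- y) =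
    \int[lam]_y (phi^\+ y + (q y)%:E) by apply: eq_integral => y _; exact: key.
have mEg : measurable_fun setT (EFin \o g) by exact/measurable_EFinP.
have mEq : measurable_fun setT (EFin \o q) by exact/measurable_EFinP.
rewrite ge0_integralD//; last 2 first.
- by move=> y _; rewrite adde_ge0// lee_fin.
- exact: emeasurable_funD.
rewrite ge0_integralD//; last by move=> y _; rewrite lee_fin.
rewrite ge0_integralD//; last by move=> y _; rewrite lee_fin.
rewrite g1 q1 [RHS in _ -> RHS = _]integralE -(fineK Nfin).
have : 0 <= \int[lam]_y klgap (g y) (q y) by exact: integral_ge0.
have : 0 <= \int[lam]_y phi^\+ y by exact: integral_ge0.
case: (\int[lam]_y klgap (g y) (q y)) => [r| |]//;
case: (\int[lam]_y phi^\+ y) => [s| |]// _ _; rewrite -?EFinD// => -[rs].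
by congr (_%:E); lra.
Qed.

Lemma integral_power_density n :
  \int[power_measure lam n]_x (\prod_(i < n) g (tnth x i))%:E = 1.
Proof.
rewrite (@ge0_integral_power_prod _ _ _ lam n (fun=> g))//.
by rewrite big1.
Qed.

End relative_entropy.

Section relative_entropy_power.
Context {d} {T : measurableType d} {R : realType}.
Variable lam : {sigma_finite_measure set T -> \bar R}.
Variables g q : T -> R.
Hypotheses (mg : measurable_fun setT g) (mq : measurable_fun setT q).
Hypotheses (g0 : forall y, (0 <= g y)%R) (q0 : forall y, (0 <= q y)%R).
Hypotheses (g1 : \int[lam]_y (g y)%:E = 1) (q1 : \int[lam]_y (q y)%:E = 1).

Let J := \int[lam]_y klgap (g y) (q y).
Let gn n (x : n.-tuple T) := (\prod_(i < n) g (tnth x i))%R.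
Let qn n (x : n.-tuple T) := (\prod_(i < n) q (tnth x i))%R.

Let mgn n : measurable_fun setT (@gn n).
Proof. exact: (measurable_tuple_prod (phi := fun=> g)). Qed.
Let mqn n : measurable_fun setT (@qn n).
Proof. exact: (measurable_tuple_prod (phi := fun=> q)). Qed.
Let gn0 n (x : n.-tuple T) : (0 <= gn x)%R. Proof. exact: prodr_ge0. Qed.
Let qn0 n (x : n.-tuple T) : (0 <= qn x)%R. Proof. exact: prodr_ge0. Qed.
Let gnS n (z : T * n.-tuple T) : gn (tcons z) = (g z.1 * gn z.2)%R.
Proof.
rewrite /gn big_ord_recl tnth_tcons0; congr (_ * _)%R.
by apply: eq_bigr => i _; rewrite tnth_tcons_lift.
Qed.
Let qnS n (z : T * n.-tuple T) : qn (tcons z) = (q z.1 * qn z.2)%R.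
Proof.
rewrite /qn big_ord_recl tnth_tcons0; congr (_ * _)%R.
by apply: eq_bigr => i _; rewrite tnth_tcons_lift.
Qed.

Let kn0 n (x : n.-tuple T) : 0 <= klgap (gn x) (qn x).
Proof. exact: klgap_ge0. Qed.

(** Subadditivity of relative entropy over independent coordinates, by induction: [klgap_mul] is
    integrated first over the last [n] coordinates, then over the first, and the unit masses of [g]
    and [q] make the correction terms cancel. *)
Lemma integral_klgap_power n :
  \int[power_measure lam n]_x klgap (\prod_(i < n) g (tnth x i))
                                    (\prod_(i < n) q (tnth x i)) <= n%:R%:E * J.
Proof.
have J0 : 0 <= J by apply: integral_ge0 => y _; exact: klgap_ge0.
rewrite -[leLHS]/(\int[power_measure lam n]_x klgap (gn x) (qn x)).
elim: n => [|n IH].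
  rewrite ge0_integral_power0; last exact: (measurable_klgap (@mgn 0) (@mqn 0)).
  rewrite mul0e /gn /qn !big_ord0 klgap_EFin ?oner_eq0//.
  by rewrite subrr mulr0 sub0r addNr.
set Jn := \int[power_measure lam n]_x klgap (gn x) (qn x) in IH.
have Jn0 : 0 <= Jn by apply: integral_ge0 => y _; exact: kn0.
(* For infinite [J] the right side is [+oo]; otherwise the induction hypothesis makes [Jn] finite as
   well. *)
have [Jfin|] := boolP (J \is a fin_num); last first.
  rewrite ge0_fin_numE// -leNgt leye_eq => /eqP ->.
  by rewrite mulry gtr0_sg ?ltr0n// mul1e leey.
have Jnfin : Jn \is a fin_num.
  rewrite ge0_fin_numE// (le_lt_trans IH)// -(fineK Jfin) -EFinM ltry//.
rewrite ge0_integral_powerS; last 2 first.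
- exact: (measurable_klgap (@mgn n.+1) (@mqn n.+1)).
- by move=> x; exact: kn0.
pose M := power_measure lam n.
have mEgn : measurable_fun setT (EFin \o @gn n) by apply/measurable_EFinP; apply: mgn.
have mEqn : measurable_fun setT (EFin \o @qn n) by apply/measurable_EFinP; apply: mqn.
have mEg : measurable_fun setT (EFin \o g) by exact/measurable_EFinP.
have mEq : measurable_fun setT (EFin \o q) by exact/measurable_EFinP.
have mk := measurable_klgap mg mq.
have mkn := measurable_klgap (@mgn n) (@mqn n).
have mkS : measurable_fun setT (fun z : T * n.-tuple T =>
    klgap (gn (tcons z)) (qn (tcons z))).
  apply: (measurableT_comp (measurable_klgap (@mgn n.+1) (@mqn n.+1))).
  exact: measurable_tcons.
have gn1 : \int[M]_x (gn x)%:E = 1 by exact: (integral_power_density mg g0 g1).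
have qn1 : \int[M]_x (qn x)%:E = 1 by exact: (integral_power_density mq q0 q1).
pose L y := \int[M]_x klgap (gn (tcons (y, x))) (qn (tcons (y, x))).
have L0 y : 0 <= L y by apply: integral_ge0 => x _; exact: kn0.
have mL : measurable_fun setT L.
  by apply: (@measurable_integral2 _ _ _ _ _ M _ mkS _ setT) => // z; exact: kn0.
(* [klgap_mul] integrated over the remaining [n] coordinates with [y] fixed. *)
have inner y : L y + (q y)%:E + (g y)%:E <=
    klgap (g y) (q y) + (g y)%:E * Jn + (g y)%:E + (q y)%:E.
  have mc (k : R) (h : n.-tuple T -> R) : measurable_fun setT h ->
      measurable_fun setT (fun x => (k * h x)%:E).
    by move=> mh; apply/measurable_EFinP; exact: measurable_funM.
  have m1 : measurable_fun setT (fun x : n.-tuple T => (gn x * q y)%:E).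
    by under eq_fun do rewrite mulrC; exact: mc.
  have m2 := mc (g y) _ (@mqn n).
  have m3 := mc (g y) _ (@mgn n).
  have m4 := mc (q y) _ (@mqn n).
  have m5 : measurable_fun setT (fun x : n.-tuple T => (gn x)%:E * klgap (g y) (q y)).
    by apply: emeasurable_funM => //; exact: measurable_cst.
  have m6 : measurable_fun setT (fun x : n.-tuple T => (g y)%:E * klgap (gn x) (qn x)).
    by apply: emeasurable_funM => //; exact: measurable_cst.
  have m7 : measurable_fun setT (fun x : n.-tuple T =>
     klgap (g y * gn x) (q y * qn x)).
    by apply: measurable_klgap; apply: measurable_funM => //; [exact: mgn|exact: mqn].
  have p5 x : 0 <= (gn x)%:E * klgap (g y) (q y) by rewrite mule_ge0 ?klgap_ge0 ?lee_fin.
  have p6 (x : n.-tuple T) : 0 <= (g y)%:E * klgap (gn x) (qn x).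
    by rewrite mule_ge0 ?klgap_ge0 ?lee_fin.
  have : \int[M]_x (klgap (g y * gn x) (q y * qn x) + (gn x * q y)%:E + (g y * qn x)%:E)
    <= \int[M]_x ((gn x)%:E * klgap (g y) (q y) + (g y)%:E * klgap (gn x) (qn x)
            + (g y * gn x)%:E + (q y * qn x)%:E).
    apply: ge0_le_integral => //; last by move=> x _; exact: klgap_mul.
    - by move=> x _; rewrite !adde_ge0// ?klgap_ge0// ?lee_fin mulr_ge0.
    - by do 2 apply: emeasurable_funD => //.
    - by do 3 apply: emeasurable_funD => //.
  have e1 : \int[M]_x (gn x * q y)%:E = (q y)%:E.
    under eq_integral do rewrite EFinM.
    by rewrite ge0_integralZr ?lee_fin// ?gn1 ?mul1e// => x _; rewrite lee_fin.
  have e2 : \int[M]_x (g y * qn x)%:E = (g y)%:E.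
    under eq_integral do rewrite EFinM.
    by rewrite ge0_integralZl_EFin// ?qn1 ?mule1// => x _; rewrite lee_fin.
  have e3 : \int[M]_x (g y * gn x)%:E = (g y)%:E.
    under eq_integral do rewrite EFinM.
    by rewrite ge0_integralZl_EFin// ?gn1 ?mule1// => x _; rewrite lee_fin.
  have e4 : \int[M]_x (q y * qn x)%:E = (q y)%:E.
    under eq_integral do rewrite EFinM.
    by rewrite ge0_integralZl_EFin// ?qn1 ?mule1// => x _; rewrite lee_fin.
  have e5 : \int[M]_x ((gn x)%:E * klgap (g y) (q y)) = klgap (g y) (q y).
    by rewrite ge0_integralZr ?klgap_ge0// ?gn1 ?mul1e// => x _; rewrite lee_fin.
  have e6 : \int[M]_x ((g y)%:E * klgap (gn x) (qn x)) = (g y)%:E * Jn.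
    by rewrite ge0_integralZl_EFin// => x _; rewrite klgap_ge0.
  have e7 : \int[M]_x klgap (g y * gn x) (q y * qn x) = L y.
    by apply: eq_integral => x _; rewrite gnS qnS.
  rewrite !ge0_integralD//; try by move=> x _; rewrite ?adde_ge0 ?klgap_ge0// lee_fin mulr_ge0.
  - by rewrite e1 e2 e3 e4 e5 e6 e7.
  - exact: emeasurable_funD.
  - by do 2 apply: emeasurable_funD => //.
  - by move=> x _; apply: klgap_ge0; rewrite mulr_ge0.
  - by move=> x _; rewrite adde_ge0 ?lee_fin ?mulr_ge0// klgap_ge0// mulr_ge0.
  - exact: emeasurable_funD.
rewrite -[leLHS]/(\int[lam]_y L y); clearbody L.
have mgJ : measurable_fun setT (fun y => (g y)%:E * Jn).
  by apply: emeasurable_funM => //; exact: measurable_cst.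
have k0 y : 0 <= klgap (g y) (q y) by exact: klgap_ge0.
have gJ0 y : 0 <= (g y)%:E * Jn by rewrite mule_ge0 ?lee_fin.
have : \int[lam]_y (L y + (q y)%:E + (g y)%:E) <=
    \int[lam]_y (klgap (g y) (q y) + (g y)%:E * Jn + (g y)%:E + (q y)%:E).
  apply: ge0_le_integral => //.
  - by move=> y _; apply: adde_ge0; [apply: adde_ge0; [exact: L0|exact: q0]|exact: g0].
  - by do 2 apply: emeasurable_funD => //.
  - by do 3 apply: emeasurable_funD => //.
rewrite !ge0_integralD//; try by move=> y _; rewrite ?adde_ge0 ?lee_fin.
all: try by do 3 (apply: emeasurable_funD => //).
rewrite ge0_integralZr//; last by move=> y _; rewrite lee_fin.
rewrite g1 q1 mul1e -/J => key.
rewrite (@le_trans _ _ (J + Jn))//.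
  by move: key; rewrite !leeD2rE.
by rewrite -natr1 EFinD ge0_muleDl ?lee_fin// mul1e [leRHS]addeC leeD2l.
Qed.

(** Markov's inequality for relative entropy: on this set [klgap] is at least [(s - 1)] times the
    product density of [g]. For [s <= 1] the left side is nonpositive. *)
Lemma power_density_tail n s : (0 <= s)%R ->
  (s - 1)%:E * \int[power_measure lam n]_(x in [set x |
      (\prod_(i < n) q (tnth x i) < expR (- s) * \prod_(i < n) g (tnth x i))%R])
    (\prod_(i < n) g (tnth x i))%:E <= n%:R%:E * J.
Proof.
move=> s0; have J0 : 0 <= J by apply: integral_ge0 => y _; exact: klgap_ge0.
have [s1|s1] := leP s 1%R.
  rewrite (@le_trans _ _ 0)//; last by rewrite mule_ge0 ?lee_fin.
  rewrite mule_le0_ge0 ?lee_fin ?subr_le0//.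
  by apply: integral_ge0 => x _; rewrite lee_fin; exact: gn0.
rewrite (le_trans _ (integral_klgap_power n))//.
set Z := [set x | _].
have mZ : measurable Z.
  apply: measurable_set_ltr; first exact: mqn.
  by apply: measurable_funM => //; exact: mgn.
rewrite -ge0_integralZl_EFin//; last 3 first.
- by move=> x _; rewrite lee_fin; exact: gn0.
- by apply/measurable_EFinP; apply: measurable_funS (@mgn n).
- by rewrite subr_ge0 ltW.
have mk : measurable_fun setT (fun x : n.-tuple T => klgap (gn x) (qn x)).
  exact: (measurable_klgap (@mgn n) (@mqn n)).
rewrite (@le_trans _ _ (\int[power_measure lam n]_(x in Z) klgap (gn x) (qn x)))//.
  apply: ge0_le_integral => //.
  - move=> x _; rewrite -EFinM lee_fin mulr_ge0//; last exact: gn0.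
    by rewrite subr_ge0 ltW.
  - apply/measurable_EFinP; apply: measurable_funM => //.
    by apply: measurable_funS (@mgn n).
  - by apply: measurable_funS mk.
  - by move=> x Zx; rewrite -EFinM; apply: klgap_ge_log => //; exact: qn0.
apply: ge0_subset_integral => // x _; exact: kn0.
Qed.

End relative_entropy_power.

(** * Likelihoods and evidence *)

Section finite_measure_limit.
Context d (T : measurableType d) (R : realType).

(** Since every point leaves the sets eventually, their limit superior is empty; for a finite
    measure the tail unions then have mass tending to zero. *)
Lemma measure_eventually_small (mu : {finite_measure set T -> \bar R})
    (F : nat -> set T) (eps : R) : (0 < eps)%R ->
    (forall n, measurable (F n)) -> (forall x, \forall n \near \oo, ~ F n x) ->
  \forall n \near \oo, mu (F n) <= eps%:E.
Proof.
move=> eps0 mF Fx.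
have limF0 : lim_sup_set F = set0.
  apply/seteqP; split=> // x Flim; have [N _ FN] := Fx x.
  by have [k /= Nk] := Flim N I; exact: FN.
have := lim_sup_set_cvg mu F mF.
rewrite limF0 measure0 => /(_ _)/fine_cvgP[].
  by rewrite -ge0_fin_numE// fin_num_measure//; exact: bigcup_measurable.
move=> _ /cvgrPdist_le/(_ _ eps0)[N _ FN]; exists N => // n Nn.
have mFn : measurable (\bigcup_(k in [set k | (n <= k)%N]) F k).
  exact: bigcup_measurable.
rewrite (@le_trans _ _ (mu (\bigcup_(k in [set k | (n <= k)%N]) F k)))//.
  by apply: le_measure; rewrite ?inE//; move=> x Fnx; exists n => /=.
rewrite -(@fineK _ (mu _)) ?fin_num_measure// lee_fin.
by have := FN _ Nn; rewrite /= sub0r normrN; apply: le_trans; exact: ler_norm.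
Qed.

End finite_measure_limit.

Lemma limn_einf_ge_near (R : realType) (u : (\bar R)^nat) (a b : \bar R) :
  a < b -> b <= limn_einf u -> \forall n \near \oo, a < u n.
Proof.
move=> ab; rewrite limn_einf_lim => bu.
have : a < ereal_sup (range (einfs u)).
  by rewrite (lt_le_trans ab)// (le_trans bu)// (cvg_lim _ (@cvg_einfs_sup _ u)).
move=> /ereal_sup_gt[_ [N _ <-]] aN; exists N => // n /= Nn.
by apply: (lt_le_trans aN); apply: ereal_inf_lbound; exists n.
Qed.

Section likelihood.
Context {dT dU} {T : measurableType dT} {U : measurableType dU} {R : realType}.
Variable lam : {sigma_finite_measure set T -> \bar R}.
Variable mu : {finite_measure set U -> \bar R}.
Variable w : U -> T -> R.
Hypothesis mw : measurable_fun setT (fun z : U * T => w z.1 z.2).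
Hypothesis w0 : forall theta y, (0 <= w theta y)%R.

(** With [w] the exponential of the score, [lik] is the exponential of the [n]-sample score and
    [lik_mass] is [Qn]. The analysis below is carried out for any nonnegative jointly measurable
    kernel [w]. *)
Definition lik n theta (x : n.-tuple T) : R := \prod_(i < n) w theta (tnth x i).

Definition lik_mass n (S : set (n.-tuple T)) theta : \bar R :=
  \int[power_measure lam n]_(x in S) (lik theta x)%:E.

Lemma lik_ge0 n theta (x : n.-tuple T) : (0 <= lik theta x)%R.
Proof. exact: prodr_ge0. Qed.

Lemma lik_mass_ge0 n (S : set (n.-tuple T)) theta : 0 <= lik_mass S theta.
Proof. by apply: integral_ge0 => x _; rewrite lee_fin lik_ge0. Qed.

Lemma measurable_lik n :
  measurable_fun setT (fun z : U * n.-tuple T => (lik z.1 z.2)%:E).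
Proof.
apply/measurable_EFinP; apply: measurable_prod => i _.
pose p (z : U * n.-tuple T) := (z.1, tnth z.2 i).
suff mp : measurable_fun setT p by exact: (measurableT_comp mw mp).
apply/measurable_fun_pairP; split.
  exact: measurable_fst.
exact: (measurableT_comp (@measurable_tnth _ T n i) measurable_snd).
Qed.

Lemma measurable_lik1 n (x : n.-tuple T) :
  measurable_fun setT (fun theta => (lik theta x)%:E).
Proof. exact: (measurableT_comp (@measurable_lik n) (pair2_measurable x)). Qed.

Lemma measurable_lik_mass n (S : set (n.-tuple T)) : measurable S ->
  measurable_fun setT (lik_mass S).
Proof.
move=> mS; apply: (@measurable_integral2 _ _ _ _ _ (power_measure lam n) _
  (@measurable_lik n)) => //.
by move=> z; rewrite lee_fin lik_ge0.
Qed.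

Lemma measurable_evidence n (A : set U) : measurable A ->
  measurable_fun setT (fun x : n.-tuple T => \int[mu]_(theta in A) (lik theta x)%:E).
Proof.
move=> mA; apply: (@measurable_integral2 _ _ _ _ _ mu
  (fun z : n.-tuple T * U => (lik z.2 z.1)%:E)) => //.
  exact: (measurableT_comp (@measurable_lik n) (@measurable_swap _ _ (n.-tuple T) U)).
by move=> z; rewrite lee_fin lik_ge0.
Qed.

Lemma integral_evidence n (S : set (n.-tuple T)) (A : set U) :
    measurable S -> measurable A ->
  \int[power_measure lam n]_(x in S) \int[mu]_(theta in A) (lik theta x)%:E =
  \int[mu]_(theta in A) lik_mass S theta.
Proof.
move=> mS mA; rewrite (@tonelli_within _ _ _ _ _ mu (power_measure lam n) _
  (@measurable_lik n))//.
by move=> z; rewrite lee_fin lik_ge0.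
Qed.

(** Markov's inequality under the modified prior: on the selected parameters [rho] times the total
    mass is below the mass of [S], so [rho] times the left side is at most [rho * rho * M]. The
    square shares the bound equally between prior mass and mass ratio. *)
Lemma prior_mass_large_ratio_le n (S : set (n.-tuple T)) (A : set U) (M : \bar R) (rho : R) :
    measurable S -> measurable A -> (0 < rho)%R ->
    \int[power_measure lam n]_(x in S) \int[mu]_(theta in A) (lik theta x)%:E
      <= (rho * rho)%:E * M ->
  \int[mu]_(theta in A `&`
      [set theta | rho%:E * lik_mass [set: n.-tuple T] theta < lik_mass S theta])
    lik_mass [set: n.-tuple T] theta <= rho%:E * M.
Proof.
move=> mS mA rho0; rewrite integral_evidence// => SA.
set B := A `&` _.
have mB : measurable B.
  apply: measurableI => //; apply: measurable_set_lte; last exact: measurable_lik_mass.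
  by apply: emeasurable_funM => //; exact: measurable_lik_mass.
rewrite -(@lee_pmul2l _ rho%:E) ?lte_fin//.
rewrite -ge0_integralZl_EFin//; last 3 first.
- by move=> theta _; exact: lik_mass_ge0.
- by apply: measurable_funS (@measurable_lik_mass n _ measurableT).
- exact: ltW.
rewrite muleA -EFinM (le_trans _ SA)//.
rewrite (@le_trans _ _ (\int[mu]_(theta in B) lik_mass S theta))//.
  apply: ge0_le_integral => //.
  - by move=> theta _; rewrite mule_ge0 ?lik_mass_ge0 ?lee_fin ?ltW.
  - apply: emeasurable_funM => //.
    by apply: measurable_funS (@measurable_lik_mass n _ measurableT).
  - by apply: measurable_funS (measurable_lik_mass mS).
  - by move=> theta [_ /= /ltW].
apply: ge0_subset_integral => //.
- by apply: measurable_funS (measurable_lik_mass mS).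
- by move=> theta _; exact: lik_mass_ge0.
- exact: subIsetl.
Qed.

Variable g : T -> R.
Hypotheses (mg : measurable_fun setT g) (g0 : forall y, (0 <= g y)%R).
Hypothesis g1 : \int[lam]_y (g y)%:E = 1.

Let gn n (x : n.-tuple T) := (\prod_(i < n) g (tnth x i))%R.
Let gn0 n (x : n.-tuple T) : (0 <= gn x)%R. Proof. exact: prodr_ge0. Qed.
Let mgn n : measurable_fun setT (@gn n).
Proof. exact: (measurable_tuple_prod (phi := fun=> g)). Qed.

(** Markov's inequality for the ratio of the evidence to the true density, with the density
    multiplied through so that its zeros cause no division. *)
Lemma evidence_markov n (S : set (n.-tuple T)) (A : set U) (c : R) :
    measurable S -> measurable A -> (0 <= c)%R ->
  c%:E * \int[power_measure lam n]_(x in S `&` [set x : n.-tuple T |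
      (c * \prod_(i < n) g (tnth x i))%:E < \int[mu]_(theta in A) (lik theta x)%:E])
    (\prod_(i < n) g (tnth x i))%:E <= \int[mu]_(theta in A) lik_mass S theta.
Proof.
move=> mS mA c0; rewrite -integral_evidence//; set E := S `&` _.
have mcg : measurable_fun setT (fun x : n.-tuple T => (c * gn x)%:E).
  by apply/measurable_EFinP; apply: measurable_funM => //; exact: mgn.
have mN := @measurable_evidence n A mA.
have mE : measurable E by apply: measurableI => //; exact: measurable_set_lte.
rewrite -ge0_integralZl_EFin//; last 2 first.
- by move=> x _; rewrite lee_fin; exact: gn0.
- by apply/measurable_EFinP; apply: measurable_funS (@mgn n).
rewrite (@le_trans _ _ (\int[power_measure lam n]_(x in E)
    \int[mu]_(theta in A) (lik theta x)%:E))//.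
  apply: ge0_le_integral => //.
  - by move=> x _; rewrite -EFinM lee_fin mulr_ge0//; exact: gn0.
  - by apply: measurable_funS mcg.
  - by apply: measurable_funS mN.
  - by move=> x [_ /= /ltW].
apply: ge0_subset_integral => //.
- by apply: measurable_funS mN.
- by move=> x _; apply: integral_ge0 => theta _; rewrite lee_fin lik_ge0.
- exact: subIsetl.
Qed.

End likelihood.

(** * Lower bound on the evidence *)

Section evidence_lower_bounds.
Context {dT dU} {T : measurableType dT} {U : measurableType dU} {R : realType}.
Variable lam : {sigma_finite_measure set T -> \bar R}.
Variables mu pit : {finite_measure set U -> \bar R}.
Variable w : U -> T -> R.
Hypothesis mw : measurable_fun setT (fun z : U * T => w z.1 z.2).
Hypothesis w0 : forall theta y, (0 <= w theta y)%R.
Variable g : T -> R.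
Hypotheses (mg : measurable_fun setT g) (g0 : forall y, (0 <= g y)%R).
Hypothesis g1 : \int[lam]_y (g y)%:E = 1.
Variable Theta : set U.
Hypothesis mTheta : measurable Theta.
Hypothesis w_fin : forall theta, \int[lam]_y (w theta y)%:E < +oo.
Hypothesis w_gt0 : forall theta, Theta theta -> 0 < \int[lam]_y (w theta y)%:E.

(** This is [Q] of the whole space as a real number, and [normalized] below is the modified
    density. *)
Definition total_mass theta : R := fine (\int[lam]_y (w theta y)%:E).

Definition normalized theta y : R := (w theta y / total_mass theta)%R.

Let M n := \int[mu]_(theta in Theta) lik_mass lam w [set: n.-tuple T] theta.
Hypothesis M_fin : forall n, (0 < n)%N -> 0 < M n < +oo.
Variable h : nat -> U -> \bar R.
Hypothesis mh : forall n, (0 < n)%N -> measurable_fun Theta (h n).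
Hypothesis hE : forall n A, (0 < n)%N -> measurable A -> A `<=` Theta ->
  \int[mu]_(theta in A) lik_mass lam w [set: n.-tuple T] theta / M n =
  \int[pit]_(theta in A) h n theta.
Hypothesis h_liminf : forall (r : R) theta, (0 < r)%R -> Theta theta ->
  1 <= limn_einf (fun n => (expR (n%:R * r))%:E * h n theta).
Hypothesis dense : forall e : R, (0 < e)%R ->
  0 < pit (Theta `&` [set theta | \int[lam]_y klgap (g y) (normalized theta y) < e%:E]).

Let gn n (x : n.-tuple T) := (\prod_(i < n) g (tnth x i))%R.
Let gn0 n (x : n.-tuple T) : (0 <= gn x)%R. Proof. exact: prodr_ge0. Qed.
Let mgn n : measurable_fun setT (@gn n).
Proof. exact: (measurable_tuple_prod (phi := fun=> g)). Qed.

Lemma total_massE theta : (total_mass theta)%:E = \int[lam]_y (w theta y)%:E.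
Proof.
by rewrite fineK// ge0_fin_numE//; apply: integral_ge0 => y _; rewrite lee_fin.
Qed.

Lemma total_mass_gt0 theta : Theta theta -> (0 < total_mass theta)%R.
Proof. by move=> /w_gt0; rewrite -total_massE. Qed.

Lemma total_mass_ge0 theta : (0 <= total_mass theta)%R.
Proof.
by rewrite -lee_fin total_massE; apply: integral_ge0 => y _; rewrite lee_fin.
Qed.

Lemma measurable_total_mass : measurable_fun setT total_mass.
Proof.
apply/measurable_EFinP; rewrite (_ : _ \o _ = fun theta => \int[lam]_y (w theta y)%:E).
  apply: (@measurable_integral2 _ _ _ _ _ lam (fun z => (w z.1 z.2)%:E)) => //.
    exact/measurable_EFinP.
  by move=> z; rewrite lee_fin.
by apply/funext => theta; exact: total_massE.
Qed.

Lemma normalized_ge0 theta y : (0 <= normalized theta y)%R.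
Proof. by rewrite divr_ge0// total_mass_ge0. Qed.

Lemma measurable_normalized :
  measurable_fun setT (fun z : U * T => normalized z.1 z.2).
Proof.
(* The inverse is written as a power with exponent [-1], which is measurable and agrees with it on
   nonnegative reals. *)
rewrite (_ : (fun _ => _) =
    fun z : U * T => (w z.1 z.2 * total_mass z.1 `^ (-1))%R); last first.
  by apply/funext => z; rewrite powR_inv1 ?total_mass_ge0.
apply: measurable_funM => //.
apply: (measurableT_comp (measurable_powR (-1))).
exact: (measurableT_comp measurable_total_mass).
Qed.

Lemma integral_normalized theta : Theta theta ->
  \int[lam]_y (normalized theta y)%:E = 1.
Proof.
move=> Ttheta; rewrite /normalized; under eq_integral do rewrite EFinM.
have q0 := total_mass_gt0 Ttheta.
rewrite ge0_integralZr//; last 3 first.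
- apply/measurable_EFinP; exact: (measurableT_comp mw (pair1_measurable theta)).
- by move=> y _; rewrite lee_fin.
- by rewrite lee_fin invr_ge0 ltW.
by rewrite -total_massE -EFinM divff// gt_eqF.
Qed.

Lemma prod_normalized n theta (x : n.-tuple T) :
  (\prod_(i < n) normalized theta (tnth x i) = lik w theta x / total_mass theta ^+ n)%R.
Proof. by rewrite big_split/= prodr_const card_ord exprVn. Qed.

Lemma lik_massT n theta :
  lik_mass lam w [set: n.-tuple T] theta = (total_mass theta ^+ n)%:E.
Proof.
rewrite /lik_mass (@ge0_integral_power_prod _ _ _ lam n (fun=> w theta))//; last first.
  by move=> _; exact: (measurableT_comp mw (pair1_measurable theta)).
by rewrite -total_massE prodEFin prodr_const card_ord.
Qed.

Let gap theta := \int[lam]_y klgap (g y) (normalized theta y).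

Let mgap : measurable_fun setT gap.
Proof.
apply: (@measurable_integral2 _ _ _ _ _ lam
   (fun z : U * T => klgap (g z.2) (normalized z.1 z.2))) => //.
  apply: measurable_klgap; last exact: measurable_normalized.
  exact: (measurableT_comp mg).
by move=> z; apply: klgap_ge0 => //; exact: normalized_ge0.
Qed.

(** Pairs at which the [n]-fold modified density falls below [expR (- s)] times the true one,
    cleared of the denominator [total_mass ^+ n]. *)
Let Z n (s : R) : set (U * n.-tuple T) :=
  [set z | (lik w z.1 z.2 < expR (- s) * total_mass z.1 ^+ n * gn z.2)%R].

Let mZ n s : measurable (@Z n s).
Proof.
apply: measurable_set_ltr; first by apply/measurable_EFinP; exact: measurable_lik.
apply: measurable_funM; last exact: (measurableT_comp (@mgn n)).
apply: measurable_funM => //; apply: measurable_funX.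
exact: (measurableT_comp measurable_total_mass).
Qed.

Lemma lik_tail n s theta : Theta theta -> (0 <= s)%R ->
  (s - 1)%:E * \int[power_measure lam n]_(x in [set x : n.-tuple T |
      (lik w theta x < expR (- s) * total_mass theta ^+ n * \prod_(i < n) g (tnth x i))%R])
    (\prod_(i < n) g (tnth x i))%:E <= n%:R%:E * gap theta.
Proof.
move=> Ttheta s0; have q0 := total_mass_gt0 Ttheta.
have := @power_density_tail _ _ _ lam g (normalized theta) mg
  (measurableT_comp measurable_normalized (pair1_measurable theta)) g0
  (normalized_ge0 theta) g1 (integral_normalized Ttheta) n s s0.
apply: le_trans; rewrite le_eqVlt; apply/orP; left; apply/eqP; congr (_ * _).
congr (integral _ _ _); apply/seteqP; split=> x /=.
all: by rewrite prod_normalized ltr_pdivrMr ?exprn_gt0// mulrAC.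
Qed.

(** Pointwise, the liminf condition keeps [h n theta] above [expR (- (n r)) / 2] for all large [n];
    finiteness of [pit] turns this into small mass of the exceptional sets. *)
Lemma h_small r : (0 < r)%R -> forall (e : R), (0 < e)%R ->
  \forall n \near \oo, pit (Theta `&`
     [set theta | h n theta < (expR (- (n%:R * r)) / 2)%:E]) <= e%:E.
Proof.
move=> r0 e e0; pose F n := Theta `&` [set theta | h n theta < (expR (- (n%:R * r)) / 2)%:E].
have mF n : (0 < n)%N -> measurable (F n).
  by move=> n0; apply: measurable_lte => //; exact: mh.
(* Index [0] gets the empty set, since [h] is only known to be measurable for positive [n]. *)
have := @measure_eventually_small _ _ _ pit (fun n => if n is 0 then set0 else F n) e e0.
have mF' n : measurable (if n is 0 then set0 else F n) by case: n => // n; exact: mF.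
move=> /(_ mF')[theta|N _ FN].
  have [Ttheta|nTtheta] := pselect (Theta theta); last first.
    by exists 0%N => // -[|n] _ //= -[].
  (* The factor one half is the slack needed below a liminf of at least [1]. *)
  have : (2^-1)%:E < 1 :> \bar R by rewrite lte_fin invf_lt1 ?ltr1n.
  move=> /limn_einf_ge_near/(_ (h_liminf r0 Ttheta))[N _ hN].
  exists N => // -[_ []|n /hN/= hn [_ /=]].
  rewrite -(@lte_pmul2l _ (expR (n.+1%:R * r))%:E) ?lte_fin ?expR_gt0//.
  by rewrite -EFinM mulrA -expRD subrr expR0 mul1r => /(lt_trans hn); rewrite ltxx.
exists N.+1 => // n Nn; have := FN n (ltnW Nn); by case: n Nn.
Qed.

(** Restrict the mixture to [V], use the likelihood bound [a] there, and rewrite the modified prior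
    mass of [V] as the integral of [h n], which is at least [b * pit V]. *)
Lemma evidence_ge n (x : n.-tuple T) (V : set U) (a b : R) :
    (0 < n)%N -> measurable V -> V `<=` Theta -> (0 <= a)%R -> (0 <= b)%R ->
    (forall theta, V theta -> (a * total_mass theta ^+ n <= lik w theta x)%R) ->
    (forall theta, V theta -> b%:E <= h n theta) ->
  (a * fine (M n) * b)%:E * pit V <= \int[mu]_(theta in Theta) (lik w theta x)%:E.
Proof.
move=> n0 mV VTheta a0 b0 aV bV; have /andP[M0 Moo] := M_fin n0.
have Mfin : M n \is a fin_num by rewrite ge0_fin_numE// ltW.
have m0 : (0 < fine (M n))%R by rewrite fine_gt0// M0.
have mlm := measurable_lik_mass lam mw w0 (@measurableT _ (n.-tuple T)).
have mlik := measurable_lik1 mw x.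
rewrite (@le_trans _ _ (\int[mu]_(theta in V) (lik w theta x)%:E))//; last first.
  apply: ge0_subset_integral => //; first by apply: measurable_funS mlik.
  by move=> theta _; rewrite lee_fin lik_ge0.
rewrite (@le_trans _ _ (\int[mu]_(theta in V)
    (a%:E * lik_mass lam w [set: n.-tuple T] theta)))//; last first.
  apply: ge0_le_integral => //.
  - by move=> theta _; rewrite mule_ge0 ?lee_fin// lik_mass_ge0.
  - by apply: emeasurable_funM => //; apply: measurable_funS mlm.
  - by apply: measurable_funS mlik.
  - by move=> theta Vtheta; rewrite lik_massT -EFinM lee_fin; exact: aV.
rewrite ge0_integralZl_EFin//; last 2 first.
- by move=> theta _; exact: lik_mass_ge0.
- by apply: measurable_funS mlm.
rewrite -mulrA EFinM -muleA lee_wpmul2l ?lee_fin//.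
have -> : \int[mu]_(theta in V) lik_mass lam w [set: n.-tuple T] theta =
    (fine (M n))%:E * \int[pit]_(theta in V) h n theta.
  rewrite -hE// -[M n in RHS]fineK// inver gt_eqF// muleC -muleA -EFinM.
  by rewrite mulVf ?mule1// gt_eqF.
have mE0 : 0 <= (fine (M n))%:E by rewrite lee_fin ltW.
rewrite EFinM -muleA lee_wpmul2l//.
have -> : b%:E * pit V = \int[pit]_(theta in V) cst b%:E theta.
  by rewrite integral_cst.
apply: ge0_le_integral => //.
by apply: measurable_funS (mh n0).
Qed.

(** At a sample [x] with too little evidence, at least half of the [pit]-mass of [K] must lie where
    [h n] is small or where the modified likelihood is small at [x]. Integrating this over such
    samples against the true density bounds their probability, by [h_small] for the first cause and
    by Tonelli with [lik_tail] for the second. *)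
Lemma evidence_lower_bound (r delta : R) : (0 < r)%R -> (0 < delta)%R ->
  \forall n \near \oo, \int[power_measure lam n]_(x in [set x : n.-tuple T |
      \int[mu]_(theta in Theta) (lik w theta x)%:E <
      (expR (- (n%:R * r)) * fine (M n) * \prod_(i < n) g (tnth x i))%:E])
    (\prod_(i < n) g (tnth x i))%:E <= delta%:E.
Proof.
(* One third of the rate pays for the likelihood, one for the density of the prior, and one absorbs
   the constant [kappa]. *)
move=> r0 delta0; pose r' := (r / 3)%R; have r'0 : (0 < r')%R by rewrite divr_gt0.
(* Chosen so that, with [s = n r'] and [s >= 2], the entropy bound [n eps / (s - 1)] is at most
   [delta / 4]. *)
pose eps := (delta * r' / 8)%R.
have eps0 : (0 < eps)%R by rewrite divr_gt0// mulr_gt0.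
pose K := Theta `&` [set theta | gap theta < eps%:E].
have mK : measurable K by apply: measurableI => //; exact: measurable_set_lte.
pose kappa := fine (pit K).
have kappaE : kappa%:E = pit K by rewrite fineK// fin_num_measure.
have kappa0 : (0 < kappa)%R by rewrite -lte_fin kappaE; exact: dense.
(* Both causes contribute at most [kappa * delta / 4]; dividing their sum by [kappa / 2] yields
   [delta]. *)
have kd0 : (0 < kappa * delta / 4)%R by rewrite divr_gt0// mulr_gt0.
have [N1 _ FN1] := h_small r'0 kd0.
have nr'_large (b : R) : \forall n \near \oo, (b <= n%:R * r')%R.
  near=> n; rewrite -ler_pdivrMr//; near: n; exact: nbhs_infty_ger.
near=> n.
have n0 : (0 < n)%N by near: n; exists 1%N.
pose s := (n%:R * r')%R.
have s2 : (2 <= s)%R by rewrite /s; near: n; exact: nr'_large.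
have sk : (2 * expR (- s) <= kappa / 2)%R.
  rewrite -ler_pdivlMl// -[leRHS]lnK ?posrE ?mulr_gt0 ?invr_gt0// ler_expR lerNl /s.
  by near: n; exact: nr'_large.
pose F := Theta `&` [set theta | h n theta < (expR (- s) / 2)%:E].
have mF : measurable F by apply: measurable_lte => //; exact: mh.
have pF : pit F <= (kappa * delta / 4)%:E by apply: FN1 => /=; near: n; exists N1.
have /andP[M0 Moo] := M_fin n0.
have m0 : (0 < fine (M n))%R by rewrite fine_gt0// M0.
set E := [set x | _].
have mE : measurable E.
  apply: measurable_set_lte; first exact: measurable_evidence.
  by apply/measurable_EFinP; apply: measurable_funM => //; exact: mgn.
pose zg (z : U * n.-tuple T) := (\1_(@Z n s) z * gn z.2)%:E.
have zg0 z : 0 <= zg z by rewrite lee_fin mulr_ge0//; exact: gn0.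
have mzg : measurable_fun setT zg.
  apply/measurable_EFinP; apply: measurable_funM.
    exact: (measurable_indic (@mZ n s)).
  exact: (measurableT_comp (@mgn n)).
pose G x := \int[pit]_(theta in K) zg (theta, x).
have mG : measurable_fun setT G.
  apply: (@measurable_integral2 _ _ _ _ _ pit (fun z => zg (z.2, z.1))) => //.
  exact: (measurableT_comp mzg (@measurable_swap _ _ (n.-tuple T) U)).
have G0 x : 0 <= G x by exact: integral_ge0.
have mZx (x : n.-tuple T) : measurable [set theta | @Z n s (theta, x)].
  rewrite -[X in measurable X]setTI.
  exact: (pair2_measurable x measurableT (@mZ n s)).
have GE (x : n.-tuple T) :
  G x = (gn x)%:E * pit (K `&` [set theta | @Z n s (theta, x)]).
  rewrite setIC -integral_indic//.
  rewrite -ge0_integralZl_EFin//; last first.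
    by apply/measurable_EFinP; exact: (measurable_indic (mZx x)).
  by apply: eq_integral => theta _; rewrite -EFinM mulrC !indicE.
have key x : E x -> (kappa / 2 * gn x)%:E <= pit F * (gn x)%:E + G x.
  (* [V] is the part of [K] where both lower bounds hold at [x]. *)
  move=> Ex; pose V := K `&` ~` F `&` ~` [set theta | @Z n s (theta, x)].
  have mV : measurable V.
    by apply: measurableI; [apply: measurableI => //|]; apply: measurableC => //; exact: mZx.
  have KV : K `<=` V `|` F `|` (K `&` [set theta | @Z n s (theta, x)]).
    move=> theta Ktheta.
    have [Ztheta|nZ] := pselect (@Z n s (theta, x)); first by right.
    by left; have [Ftheta|nF] := pselect (F theta); [right|left].
  have KVle : kappa%:E <= pit V + pit F + pit (K `&` [set theta | @Z n s (theta, x)]).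
    rewrite kappaE; apply: (@le_trans _ _ (pit (V `|` F `|`
        (K `&` [set theta | @Z n s (theta, x)])))).
      by apply: le_measure => //; rewrite inE//; do ?apply: measurableU => //;
        apply: measurableI => //; exact: mZx.
    apply: (le_trans (measureU2 _ _ _)) => //; first exact: measurableU.
      by apply: measurableI => //; exact: mZx.
    by rewrite leeD2r// measureU2.
  (* The evidence is nonnegative, so the strict inequality defining [E] excludes zeros of the true
     density. *)
  have gx0 : (0 < gn x)%R.
    rewrite lt_neqAle eq_sym gn0 andbT; apply/eqP => gx0.
    move: Ex; rewrite /E/= -/(gn x) gx0 mulr0 ltNge => /negP; apply.
    by apply: integral_ge0 => theta _; rewrite lee_fin lik_ge0.
  (* With [e = expR (- s)], [evidence_ge] gives [e * e / 2 * pit V < e ^ 3] up to the common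
     positive factor, so [pit V < 2 * e], which is at most [kappa / 2] by [sk]. *)
  have pV : pit V <= (kappa / 2)%:E.
    have : (expR (- s) * gn x * fine (M n) * (expR (- s) / 2))%:E * pit V <=
        \int[mu]_(theta in Theta) (lik w theta x)%:E.
      apply: evidence_ge => //.
      - by move=> theta [[[]]].
      - by rewrite mulr_ge0// expR_ge0.
      - by move=> theta [_ /negP]; rewrite -leNgt/= mulrAC.
      - move=> theta [[[Ttheta _] nF] _]; rewrite leNgt; apply/negP => hF.
        exact: nF.
    move=> /le_lt_trans/(_ Ex); rewrite -(@fineK _ (pit V)) ?fin_num_measure//.
    rewrite -EFinM lte_fin lee_fin -/(gn x).
    have -> : (expR (- (n%:R * r)) = expR (- s) * expR (- s) * expR (- s))%R.
      by rewrite -!expRD /s /r'; congr expR; field.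
    move: sk; have := expR_gt0 (- s); move: (expR (- s)) => e e0 sk.
    rewrite [ltRHS](_ : _ = e * gn x * fine (M n) * (e / 2) * (2 * e))%R; last by field.
    rewrite ltr_pM2l; last by rewrite !mulr_gt0// divr_gt0.
    by move=> /ltW/le_trans; apply.
  rewrite GE muleC -ge0_muleDr//.
  rewrite mulrC EFinM lee_pmul2l// ?lte_fin//.
  have : kappa%:E <= (kappa / 2)%:E + (pit F + pit (K `&` [set theta | @Z n s (theta, x)])).
    by rewrite (le_trans KVle)// -addeA leeD2r.
  rewrite {1}(_ : kappa = kappa / 2 + kappa / 2)%R; last by field.
  by rewrite EFinD leeD2lE.
(* After exchanging the integrals, [lik_tail] applies to each parameter of [K], whose entropy is
   below [eps]. *)
have GK : \int[power_measure lam n]_x G x <= (n%:R * eps / (s - 1))%:E * kappa%:E.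
  rewrite (@tonelli_within _ _ _ _ _ (power_measure lam n) pit
    (fun z => zg (z.2, z.1)))//; last first.
    exact: (measurableT_comp mzg (@measurable_swap _ _ (n.-tuple T) U)).
  rewrite kappaE -integral_cst//.
  apply: ge0_le_integral => //.
  - by move=> theta _; exact: integral_ge0.
  - apply: measurable_funS (@measurable_integral2 _ _ _ _ _
      (power_measure lam n) zg mzg zg0 setT measurableT) => //.
  - move=> theta [Ttheta gaptheta].
    have s0 : (0 <= s)%R by rewrite (le_trans _ s2).
    have s1 : (0 < s - 1)%R by rewrite subr_gt0 (lt_le_trans _ s2)// ltr1n.
    have := @lik_tail n s theta Ttheta s0.
    rewrite integral_mkcond => tail.
    rewrite /= EFinM -lee_pdivrMr ?invr_gt0// invrK muleC.
    rewrite (@le_trans _ _ (n%:R%:E * gap theta))//; last first.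
      by rewrite EFinM lee_wpmul2l ?lee_fin// ltW.
    apply: le_trans tail; rewrite lee_wpmul2l ?lee_fin ?(ltW s1)//.
    rewrite le_eqVlt; apply/orP; left; apply/eqP; apply: eq_integral => x _.
    rewrite patchE /zg indicE (_ : ((theta, x) \in _) = (x \in [set x : n.-tuple T |
      (lik w theta x < expR (- s) * total_mass theta ^+ n * gn x)%R])); last first.
      by apply/idP/idP; rewrite !inE.
    by case: (x \in _); rewrite ?mul1r ?mul0r.
have gE1 : \int[power_measure lam n]_(x in E) (gn x)%:E <= 1.
  rewrite -(integral_power_density mg g0 g1 n); apply: ge0_subset_integral => //.
  - by apply/measurable_EFinP; exact: mgn.
  - by move=> x _; rewrite lee_fin; exact: gn0.
set I := (X in X <= _).
have I0 : 0 <= I by apply: integral_ge0 => x _; rewrite lee_fin; exact: gn0.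
have mgE : measurable_fun E (fun x => (gn x)%:E).
  by apply/measurable_EFinP; apply: measurable_funS (@mgn n).
have : (kappa / 2)%:E * I <= pit F * I + \int[power_measure lam n]_(x in E) G x.
  rewrite /I -ge0_integralZl_EFin//; last 2 first.
  - by move=> x _; rewrite lee_fin; exact: gn0.
  - by rewrite divr_ge0// ltW.
  rewrite -ge0_integralZl//; last by move=> x _; rewrite lee_fin; exact: gn0.
  rewrite -ge0_integralD//; last 3 first.
  - by move=> x _; rewrite mule_ge0// lee_fin; exact: gn0.
  - exact: measurable_funeM.
  - by apply: measurable_funS mG.
  apply: ge0_le_integral => //.
  - by move=> x _; rewrite mule_ge0 ?lee_fin ?divr_ge0 ?(ltW kappa0)//; exact: gn0.
  - exact: measurable_funeM.
  - apply: emeasurable_funD; first exact: measurable_funeM.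
    by apply: measurable_funS mG.
move=> h1; have : (kappa / 2)%:E * I <= (kappa * delta / 2)%:E.
  apply: (le_trans h1).
  apply: (@le_trans _ _ ((kappa * delta / 4)%:E + (kappa * delta / 4)%:E)); last first.
    by rewrite -EFinD lee_fin; lra.
  apply: leeD.
    rewrite -[leRHS]mule1; apply: lee_pmul => //.
  apply: (@le_trans _ _ (\int[power_measure lam n]_x G x)).
    exact: ge0_subset_integral.
  apply: (le_trans GK); rewrite -EFinM lee_fin.
  rewrite mulrAC ler_pdivrMr; last by rewrite subr_gt0 (lt_le_trans _ s2)// ltr1n.
  rewrite (_ : n%:R * eps * kappa = kappa * delta / 8 * s)%R; last by rewrite /eps /s; ring.
  have := mulr_gt0 kappa0 delta0; move: (kappa * delta)%R => kd; nra.
rewrite [(kappa * delta / 2)%R](_ : _ = kappa / 2 * delta)%R; last by ring.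
by rewrite [(kappa / 2 * delta)%:E]EFinM lee_pmul2l// lte_fin divr_gt0.
Unshelve. all: end_near. Qed.

End evidence_lower_bounds.

(** * The robust score as a likelihood *)

Lemma measurable_fine_ge0 d (T : measurableType d) (R : realType) (F : T -> \bar R) :
    measurable_fun setT F -> (forall x, 0 <= F x < +oo) ->
  measurable_fun setT (fun x => fine (F x)).
Proof.
move=> mF F0; apply/measurable_EFinP; rewrite (_ : _ \o _ = F)//.
apply/funext => x /=; have /andP[Fx0 Fxoo] := F0 x.
by rewrite fineK// ge0_fin_numE.
Qed.

Section score.
Context {d dU} {T : measurableType d} {U : measurableType dU} {R : realType}.
Variables (lam : {sigma_finite_measure set T -> \bar R}) (alpha : R).
Variables (f : U -> T -> R) (Theta : set U).
Hypothesis mTheta : measurable Theta.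
Hypothesis mf : measurable_fun (Theta `*` [set: T]) (fun z => f z.1 z.2).
Hypothesis f0 : forall theta y, Theta theta -> (0 <= f theta y)%R.
Hypothesis alpha0 : (0 <= alpha)%R.
Hypothesis HQ : forall theta, Theta theta -> 0 < Q lam alpha f setT theta < +oo.

(* Cut off outside [Theta], where nothing is assumed about [f], so as to be
   jointly measurable on the whole product. *)
Definition exp_score theta y : R :=
  if theta \in Theta then fine (expeR (qscore lam alpha f theta y)) else 0%R.

Let I theta := \int[lam]_z (f theta z `^ (1 + alpha))%:E.

Let I_ge0 theta : 0 <= I theta.
Proof. by apply: integral_ge0 => z _; rewrite lee_fin powR_ge0. Qed.

(** If the integral diverged, the score would be [-oo] everywhere and [Q] would vanish, against its
    assumed positivity. *)
Let I_lty theta : Theta theta -> alpha != 0%R -> I theta < +oo.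
Proof.
move=> Ttheta aN0; rewrite ltNge leye_eq; apply/eqP => Ioo.
have := HQ Ttheta; rewrite /Q integral0_eq ?ltxx// => y _.
rewrite /qscore (negbTE aN0) -/(I theta) Ioo mulry gtr0_sg ?mul1e//.
by rewrite invr_gt0 ltr_wpDr.
Qed.

Let expeR_qscore0 theta y : Theta theta -> alpha = 0%R ->
  expeR (qscore lam alpha f theta y) = (f theta y * expR (-1))%:E.
Proof.
move=> Ttheta a0; rewrite /qscore a0 eqxx expeRD lneK; first by rewrite -EFinM.
by rewrite in_itv/= lee_fin f0//= leey.
Qed.

Let expeR_qscoreN0 theta y : Theta theta -> alpha != 0%R ->
  expeR (qscore lam alpha f theta y) =
  (expR (alpha^-1 * (f theta y `^ alpha - 1)) *
   expR (- ((1 + alpha)^-1 * fine (I theta))))%:E.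
Proof.
move=> Ttheta aN0; rewrite /qscore (negbTE aN0) -/(I theta).
rewrite -[in LHS](@fineK _ (I theta)) ?ge0_fin_numE ?I_lty//.
by rewrite -EFinM -EFinB /= expRD.
Qed.

Lemma exp_scoreE theta y : Theta theta ->
  expeR (qscore lam alpha f theta y) = (exp_score theta y)%:E.
Proof.
move=> Ttheta; rewrite /exp_score mem_set//.
have [a0|aN0] := eqVneq alpha 0%R; first by rewrite expeR_qscore0.
by rewrite expeR_qscoreN0.
Qed.

Lemma exp_score_ge0 theta y : (0 <= exp_score theta y)%R.
Proof. by rewrite /exp_score; case: ifP => // _; rewrite fine_ge0// expeR_ge0. Qed.

Let f' theta y : R := if theta \in Theta then f theta y else 0%R.

Let mf' : measurable_fun setT (fun z : U * T => f' z.1 z.2).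
Proof.
apply/measurable_EFinP.
rewrite (_ : _ \o _ = (fun z : U * T => (f z.1 z.2)%:E) \_ (Theta `*` [set: T])).
  apply/(measurable_restrictT _ _).1; first exact: measurableX.
  exact/measurable_EFinP.
apply/funext => -[theta y] /=; rewrite patchE /f' in_setX in_setT andbT/=.
by case: ifP.
Qed.

Lemma measurable_exp_score :
  measurable_fun setT (fun z : U * T => exp_score z.1 z.2).
Proof.
have [a0|aN0] := eqVneq alpha 0%R.
  rewrite (_ : (fun _ => _) = fun z : U * T => (f' z.1 z.2 * expR (-1))%R).
    exact: measurable_funM.
  apply/funext => z; rewrite /exp_score /f'.
  by case: ifPn => [/set_mem h|_]; rewrite ?mul0r// expeR_qscore0.
pose I' theta := \int[lam]_z (f' theta z `^ (1 + alpha))%:E.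
have a1 : (1 + alpha != 0)%R by rewrite gt_eqF// ltr_wpDr.
have I'E theta : I' theta = if theta \in Theta then I theta else 0.
  rewrite /I' /f'; case: ifP => // _.
  by rewrite integral0_eq// => y _; rewrite powR0.
have mI' : measurable_fun setT I'.
  apply: (@measurable_integral2 _ _ _ _ _ lam
    (fun z : U * T => (f' z.1 z.2 `^ (1 + alpha))%:E)) => //.
    by apply/measurable_EFinP; exact: (measurableT_comp (measurable_powR _) mf').
  by move=> z; rewrite lee_fin powR_ge0.
have I'fin theta : 0 <= I' theta < +oo.
  rewrite I'E; case: ifPn => [/set_mem h|_]; last by rewrite lexx ltry.
  by rewrite I_ge0 I_lty.
have mfI' := measurable_fine_ge0 mI' I'fin.
(* The indicator is required because the exponential formula is positive even where the cut-off
   density [f'] is zero. *)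
rewrite (_ : (fun _ => _) = fun z : U * T => (\1_Theta z.1 *
   (expR (alpha^-1 * (f' z.1 z.2 `^ alpha - 1)) *
   expR (- ((1 + alpha)^-1 * fine (I' z.1)))))%R).
  apply: measurable_funM.
    exact: (measurableT_comp (measurable_indic mTheta) measurable_fst).
  apply: measurable_funM; apply: (measurableT_comp (@measurable_expR R)).
    apply: measurable_funM => //; apply: measurable_funB => //.
    exact: (measurableT_comp (measurable_powR _) mf').
  apply: measurableT_comp => //; apply: measurable_funM => //.
  exact: (measurableT_comp mfI' measurable_fst).
apply/funext => z; rewrite /exp_score indicE /f' I'E.
by case: ifPn => [/set_mem h|_]; rewrite ?mul0r// expeR_qscoreN0// mul1r.
Qed.

Let w := exp_score.

Lemma exp_score_nE n theta (x : n.-tuple T) : Theta theta ->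
  expeR (qscore_n lam alpha f theta x) = (lik w theta x)%:E.
Proof.
move=> Ttheta; rewrite /qscore_n (big_morph _ (@expeRD R) (@expeR0 R)).
by rewrite /lik -prodEFin; apply: eq_bigr => i _; rewrite exp_scoreE.
Qed.

Lemma QE theta : Theta theta ->
  Q lam alpha f setT theta = \int[lam]_y (w theta y)%:E.
Proof. by move=> Ttheta; apply: eq_integral => y _; rewrite exp_scoreE. Qed.

Lemma QnE n (S : set (n.-tuple T)) theta : Theta theta ->
  Qn lam alpha f n S theta = lik_mass lam w S theta.
Proof. by move=> Ttheta; apply: eq_integral => x _; rewrite exp_score_nE. Qed.

Lemma exp_score_int_lty theta : \int[lam]_y (w theta y)%:E < +oo.
Proof.
have [Ttheta|Ttheta] := pselect (Theta theta).
  by rewrite -QE//; have /andP[] := HQ Ttheta.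
by rewrite integral0_eq ?ltry// => y _; rewrite /w /exp_score memNset.
Qed.

Lemma exp_score_int_gt0 theta : Theta theta -> 0 < \int[lam]_y (w theta y)%:E.
Proof. by move=> Ttheta; rewrite -QE//; have /andP[] := HQ Ttheta. Qed.

Lemma modified_densityE theta : Theta theta ->
  modified_density lam alpha f theta = EFin \o normalized lam w theta.
Proof.
move=> Ttheta; apply/funext => y; rewrite /modified_density exp_scoreE// QE//=.
rewrite -(total_massE exp_score_ge0 exp_score_int_lty) inver gt_eqF//.
exact: (total_mass_gt0 exp_score_ge0 exp_score_int_lty exp_score_int_gt0).
Qed.

Variable pi : {measure set U -> \bar R}.
Hypothesis pi_fin : pi Theta < +oo.

(* [pi] may be infinite outside [Theta]; its restriction is finite, as Tonelli's
   theorem requires. *)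
Definition prior : {finite_measure set U -> \bar R} := mfrestr mTheta pi_fin.

Lemma integral_prior (A : set U) (F G : U -> \bar R) : A `<=` Theta ->
    (forall theta, Theta theta -> F theta = G theta) ->
  \int[pi]_(theta in A) F theta = \int[prior]_(theta in A) G theta.
Proof.
move=> ATheta FG; rewrite (eq_measure_integral prior).
  by apply: eq_integral => theta /set_mem/ATheta/FG.
move=> B mB BA; rewrite /prior/= /mfrestr /mrestr setIidl//.
exact: subset_trans BA ATheta.
Qed.

Lemma MnE n (S : set (n.-tuple T)) (A : set U) : A `<=` Theta ->
  Mn lam alpha f pi n S A = \int[prior]_(theta in A) lik_mass lam w S theta.
Proof. by move=> ATheta; apply: integral_prior => // theta; exact: QnE. Qed.

Lemma posteriorE n (A : set U) (x : n.-tuple T) : A `<=` Theta ->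
  posterior lam alpha f Theta pi A x =
  (\int[prior]_(theta in A) (lik w theta x)%:E) /
  (\int[prior]_(theta in Theta) (lik w theta x)%:E).
Proof.
move=> ATheta; rewrite /posterior; congr (_ / _);
  by apply: integral_prior => // theta; exact: exp_score_nE.
Qed.

End score.

(** * Posterior bounds *)

Section convergence.
Context {R : realType}.

Lemma ge0_cvge0P (u : (\bar R)^nat) : (forall n, 0 <= u n) ->
  u @ \oo --> 0 <-> forall e : R, (0 < e)%R -> \forall n \near \oo, u n <= e%:E.
Proof.
move=> u0; split=> [/fine_cvgP[ufin /cvgrPdist_le uc] e e0|ule].
  near=> n; rewrite -(@fineK _ (u n)); last by near: n.
  rewrite lee_fin (le_trans (ler_norm _))// -normrN -[X in `|X|%R]add0r.
  by near: n; exact: uc.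
apply/fine_cvgP; split.
  have := ule 1%R ltr01; apply: filterS => n un.
  by rewrite ge0_fin_numE// (le_lt_trans un)// ltry.
apply/cvgrPdist_le => e e0; have := ule e e0; apply: filterS => n un.
rewrite sub0r normrN/= ger0_norm ?fine_ge0//.
by rewrite -lee_fin fineK// ge0_fin_numE// (le_lt_trans un)// ltry.
Unshelve. all: end_near. Qed.

Lemma probability_setC_cvg0 d (T : measurableType d) (P : probability T R)
    (F : nat -> set T) : (forall n, measurable (F n)) ->
  (fun n => P (F n)) @ \oo --> 1 <-> (fun n => P (~` F n)) @ \oo --> 0.
Proof.
move=> mF.
have aux (v w : (\bar R)^nat) (a b : \bar R) : a \is a fin_num ->
   (forall n, w n = 1 - v n) -> b = 1 - a -> v @ \oo --> a -> w @ \oo --> b.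
  move=> afin vw -> va; rewrite (_ : w = fun n => 1 - v n); last exact/funext.
  apply: cvgeB; [|exact: cvg_cst|exact: va].
  by rewrite fin_num_adde_defr.
split; apply: aux => //; rewrite ?subee ?sube0// => n.
  by rewrite probability_setC.
by rewrite -[F n in LHS]setCK probability_setC//; exact: measurableC.
Qed.

End convergence.

Section quotient.
Context {R : realType}.
Implicit Types N D : \bar R.

(** With the conventions [x / +oo = 0] and [0 / 0 = 0], a strict bound on a quotient has three
    sources. The hypothesis [N <= D], valid for integrals over nested sets, excludes a positive
    numerator over zero. This form also shows the posterior events to be measurable. *)
Lemma lte_quotient N D (c : R) : 0 <= N -> N <= D -> (0 < c)%R ->
  (N / D < c%:E) <-> [\/ D = +oo, N = 0 | N < c%:E * D].
Proof.
move=> N0 ND c0; case: D ND => [D ND| _|/(le_trans N0)//]; last first.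
  by rewrite invey mule0 lte_fin; split=> // _; exact: Or31.
have D0 : (0 <= D)%R by rewrite -lee_fin (le_trans N0).
have [D00|DN0] := eqVneq D 0%R.
  have -> : N = 0 by apply/eqP; rewrite eq_le N0 andbT (le_trans ND)// D00.
  by rewrite mul0e lte_fin; split=> // _; exact: Or32.
have Dp : (0 < D)%R by rewrite lt_neqAle eq_sym DN0.
rewrite inver (negbTE DN0) lte_pdivrMr//; split=> [h|[//|->|//]]; first exact: Or33.
by rewrite -EFinM lte_fin mulr_gt0.
Qed.

End quotient.

Section consistency.
Context {dO d} {Omega : measurableType dO} {T : measurableType d}.
Context {dU} {U : measurableType dU} {R : realType}.
Variables (P : probability Omega R) (X : nat -> {RV P >-> T}).
Hypothesis Xindep : mutually_independent X.
Variables (lam : {sigma_finite_measure set T -> \bar R}) (G : probability T R).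
Hypothesis Xlaw : forall i (S : set T), measurable S -> distribution P (X i) S = G S.
Variable g : T -> R.
Hypothesis Gg : is_density lam G g.
Variables (mu : {finite_measure set U -> \bar R}) (w : U -> T -> R).
Hypothesis mw : measurable_fun setT (fun z : U * T => w z.1 z.2).
Hypothesis w0 : forall theta y, (0 <= w theta y)%R.
Hypothesis w_fin : forall theta, \int[lam]_y (w theta y)%:E < +oo.
Variable Theta : set U.
Hypothesis mTheta : measurable Theta.
Hypothesis w_gt0 : forall theta, Theta theta -> 0 < \int[lam]_y (w theta y)%:E.

Let evid n (A : set U) (x : n.-tuple T) := \int[mu]_(theta in A) (lik w theta x)%:E.
Let lm n (S : set (n.-tuple T)) := lik_mass lam w S.
Let M n (A : set U) := \int[mu]_(theta in A) lm [set: n.-tuple T] theta.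
Hypothesis M_fin : forall n, (0 < n)%N -> 0 < M n Theta < +oo.

Let evid_ge0 n A (x : n.-tuple T) : 0 <= evid A x.
Proof. by apply: integral_ge0 => theta _; rewrite lee_fin lik_ge0. Qed.

Let evid_le n A B (x : n.-tuple T) : measurable A -> measurable B -> A `<=` B ->
  evid A x <= evid B x.
Proof.
move=> mA mB AB; apply: ge0_subset_integral => //.
  by apply: measurable_funS (measurable_lik1 mw x).
by move=> theta _; rewrite lee_fin lik_ge0.
Qed.

Let evid_leU n A B C (x : n.-tuple T) : measurable A -> measurable B ->
  measurable C -> A `<=` B `|` C -> evid A x <= evid B x + evid C x.
Proof.
move=> mA mB mC ABC; have mCB := measurableD mC mB.
apply: (@le_trans _ _ (evid (B `|` (C `\` B)) x)).
  apply: evid_le => //; first exact: measurableU.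
  by rewrite setUDr setDv setD0.
rewrite /evid ge0_integral_setU//.
- by rewrite leeD2l//; apply: evid_le => //; exact: subDsetl.
- exact: measurable_funS (measurable_lik1 mw x).
- by move=> theta _; rewrite lee_fin lik_ge0.
- by rewrite disj_set2E setDIK.
Qed.

Let measurable_evid n A : measurable A -> measurable_fun setT (@evid n A).
Proof. exact: measurable_evidence. Qed.

Lemma measurable_evidence_quotient n A (c : R) : measurable A -> A `<=` Theta -> (0 < c)%R ->
  measurable [set x : n.-tuple T | evid A x / evid Theta x < c%:E].
Proof.
move=> mA AT c0; rewrite (_ : [set x | _] = [set x | evid Theta x = +oo] `|`
  [set x | evid A x = 0] `|` [set x | evid A x < c%:E * evid Theta x]).
  have meq B b : measurable B -> measurable [set x : n.-tuple T | evid B x = b].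
    move=> mB; rewrite -[X in measurable X]setTI.
    by apply: measurable_eqe => //; exact: measurable_evid.
  apply: measurableU; first by apply: measurableU; exact: meq.
  apply: measurable_set_lte; first exact: measurable_evid.
  by apply: measurable_funeM; exact: measurable_evid.
apply/seteqP; split=> x /=.
  move=> /lte_quotient[||//|||] //; first exact: evid_le.
  - by left; left.
  - by left; right.
  - by right.
move=> h; apply/lte_quotient => //; first exact: evid_le.
by case: h => [[h|h]|h]; [exact: Or31|exact: Or32|exact: Or33].
Qed.

(** Off [S n] the evidence of [A] is at most [rho * rho] times that of [Theta]. Integrating this
    over samples gives the hypothesis of [prior_mass_large_ratio_le]; the second claim is the
    negation of the inequality that defines [B]. *)
Lemma modified_prior_split (S : forall n, set (n.-tuple T)) n (A : set U) (rho : R) :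
    (0 < n)%N -> (0 < rho)%R -> measurable A -> A `<=` Theta ->
    S n = ~` [set x | evid A x / evid Theta x < (rho * rho)%:E] ->
  let B := A `&` [set theta | rho%:E * lm [set: n.-tuple T] theta < lm (~` S n) theta] in
  M n B / M n Theta <= rho%:E /\
  (forall theta, (A `\` B) theta -> lm (~` S n) theta / lm [set: n.-tuple T] theta <= rho%:E).
Proof.
move=> n0 rho0 mA AT SE B; have /andP[M0 Moo] := M_fin n0.
have Mfin : M n Theta \is a fin_num by rewrite ge0_fin_numE// ltW.
have m0 : (0 < fine (M n Theta))%R by rewrite fine_gt0// M0.
have rr0 : (0 < rho * rho)%R by rewrite mulr_gt0.
have mS : measurable (~` S n).
  by rewrite SE setCK; exact: measurable_evidence_quotient.
split.
  rewrite -[M n Theta]fineK// inver gt_eqF// lee_pdivrMr// fineK//.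
  apply: prior_mass_large_ratio_le => //.
  rewrite (@le_trans _ _ (\int[power_measure lam n]_(x in ~` S n)
     ((rho * rho)%:E * evid Theta x)))//.
    apply: ge0_le_integral => //.
    - by move=> x _; exact: evid_ge0.
    - by apply: measurable_funS (@measurable_evid n A mA).
    - by apply: measurable_funeM; apply: measurable_funS (@measurable_evid n Theta mTheta).
    - rewrite SE setCK => x /=; rewrite -/(evid A x).
      move=> /lte_quotient[|||->|->|/ltW//] //; first exact: evid_le.
        by rewrite mulry gtr0_sg// mul1e leey.
      by rewrite mule_ge0// lee_fin ltW.
  rewrite ge0_integralZl_EFin ?(ltW rr0)//; last first.
    by apply: measurable_funS (@measurable_evid n Theta mTheta).
  rewrite lee_pmul2l// /M -integral_evidence//.
  by apply: ge0_subset_integral => //; exact: measurable_evid.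
move=> theta [Atheta nB].
rewrite /lm (lik_massT mw w0 w_fin) inver.
have q0 := total_mass_gt0 w0 w_fin w_gt0 (AT _ Atheta).
rewrite gt_eqF ?exprn_gt0// lee_pdivrMr ?exprn_gt0// -(lik_massT mw w0 w_fin) leNgt.
by apply/negP => h; exact: nB.
Qed.

Let mg : measurable_fun setT g. Proof. by case: Gg. Qed.
Let g0 y : (0 <= g y)%R. Proof. by case: Gg. Qed.
Let g1 : \int[lam]_y (g y)%:E = 1.
Proof. by case: Gg => _ _ /(_ _ measurableT) <-; exact: probability_setT. Qed.
Let gn n (x : n.-tuple T) := (\prod_(i < n) g (tnth x i))%R.
Let gn0 n (x : n.-tuple T) : (0 <= gn x)%R. Proof. exact: prodr_ge0. Qed.
Let mgn n : measurable_fun setT (@gn n).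
Proof. exact: (measurable_tuple_prod (phi := fun=> g)). Qed.

Let law n (S : set (n.-tuple T)) := P (sample X n @^-1` S).

Let lawE n (S : set (n.-tuple T)) : measurable S ->
  law S = \int[power_measure lam n]_(x in S) (gn x)%:E.
Proof. exact: (sample_lawE Xindep Xlaw Gg). Qed.

Let law_mS n (S : set (n.-tuple T)) : measurable S -> measurable (sample X n @^-1` S).
Proof. by move=> mS; rewrite -[X in measurable X]setTI; exact: measurable_sample. Qed.

Let law_U n (S1 S2 : set (n.-tuple T)) : measurable S1 -> measurable S2 ->
  law (S1 `|` S2) <= law S1 + law S2.
Proof. by move=> mS1 mS2; rewrite /law preimage_setU measureU2//; exact: law_mS. Qed.

Let mfrac n A (c : R) : measurable A ->
  measurable [set x : n.-tuple T | (c * gn x)%:E < evid A x].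
Proof.
move=> mA; apply: measurable_set_lte; last exact: measurable_evid.
by apply/measurable_EFinP; apply: measurable_funM => //; exact: mgn.
Qed.

(** The factor [expR (- (2 * t))] is divided evenly: half goes into the threshold for the evidence,
    half remains as the probability bound. *)
Let law_markov n (S : set (n.-tuple T)) (A : set U) (t : R) :
    (0 < n)%N -> measurable S -> measurable A ->
    \int[mu]_(theta in A) lm S theta <= (expR (- (2 * t)) * fine (M n Theta))%:E ->
  law (S `&` [set x | (expR (- t) * fine (M n Theta) * gn x)%:E < evid A x])
    <= (expR (- t))%:E.
Proof.
move=> n0 mS mA SA; have /andP[M0 Moo] := M_fin n0.
have m0 : (0 < fine (M n Theta))%R by rewrite fine_gt0// M0.
set c := (expR (- t) * fine (M n Theta))%R.
have c0 : (0 < c)%R by rewrite mulr_gt0// expR_gt0.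
rewrite lawE; last by apply: measurableI => //; exact: mfrac.
rewrite -(@lee_pmul2l _ c%:E) ?lte_fin//.
apply: (@le_trans _ _ (\int[mu]_(theta in A) lm S theta)).
  exact: (evidence_markov lam mu mw w0 mg g0 mS mA (ltW c0)).
apply: (le_trans SA); rewrite -EFinM lee_fin /c mulrAC -expRD.
by rewrite (_ : - t - t = - (2 * t))%R//; ring.
Qed.

Variable pit : {finite_measure set U -> \bar R}.
Variable h : nat -> U -> \bar R.
Hypothesis mh : forall n, (0 < n)%N -> measurable_fun Theta (h n).
Hypothesis hE : forall n A, (0 < n)%N -> measurable A -> A `<=` Theta ->
  M n A / M n Theta = \int[pit]_(theta in A) h n theta.
Hypothesis h_liminf : forall (r : R) theta, (0 < r)%R -> Theta theta ->
  1 <= limn_einf (fun n => (expR (n%:R * r))%:E * h n theta).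
Hypothesis dense : forall e : R, (0 < e)%R ->
  0 < pit (Theta `&`
    [set theta | \int[lam]_y klgap (g y) (normalized lam w theta y) < e%:E]).

(** Outside five events, each of probability at most [e / 5] for large [n], the bound on the
    posterior is deterministic: numerator split over [B] and [C], denominator from
    [evidence_lower_bound]. *)
Lemma posterior_exponentially_small (A B C : nat -> set U) (r1 r2 : R)
    (S : forall n, set (n.-tuple T)) :
    (0 < r1)%R -> (0 < r2)%R ->
    (forall n, measurable (A n)) -> (forall n, A n `<=` Theta) ->
    (forall n, measurable (B n)) ->
    (forall n, measurable (C n)) -> (forall n, C n `<=` Theta) ->
    (forall n, (0 < n)%N -> A n `<=` B n `|` C n) ->
    (forall n, (0 < n)%N -> M n (B n) / M n Theta <= (expR (- (n%:R * r1)))%:E) ->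
    (forall n, measurable (S n)) -> (fun n => law (S n)) @ \oo --> 0 ->
    (forall n theta, (0 < n)%N -> C n theta ->
       lm (~` S n) theta / lm [set: n.-tuple T] theta <= (expR (- (n%:R * r2)))%:E) ->
  exists2 r : R, (0 < r)%R &
    (fun n => P [set o | evid (A n) (sample X n o) / evid Theta (sample X n o)
       < (expR (- (n%:R * r)))%:E]) @ \oo --> 1.
Proof.
move=> r10 r20 mA AT mB mC CT ABC MB mS S0 CS.
(* Half the smaller rate, so that both assumptions provide the exponent [2 * t] of [law_markov] with
   [t = n * rho]. *)
pose rho := (Num.min r1 r2 / 2)%R.
have rho0 : (0 < rho)%R by rewrite divr_gt0// lt_min r10.
have rho1 : (2 * rho <= r1)%R by rewrite mulrC divfK ?ge_min ?lexx.
have rho2 : (2 * rho <= r2)%R by rewrite mulrC divfK ?ge_min ?lexx ?orbT.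
(* With [u = expR (- (t / 4))], the numerator is at most [2 * u ^ 4] and the denominator at least
   [u ^ 2], up to a common factor; the quotient [2 * u ^ 2] is below [u] once [u < 1 / 2]. *)
exists (rho / 4)%R; first by rewrite divr_gt0.
pose good n : set (n.-tuple T) :=
  [set x | evid (A n) x / evid Theta x < (expR (- (n%:R * (rho / 4))))%:E].
have mgood n : measurable (good n).
  by apply: measurable_evidence_quotient => //; exact: expR_gt0.
apply: (proj2 (@probability_setC_cvg0 _ _ _ P
  (fun n => sample X n @^-1` good n) (fun n => law_mS (mgood n)))).
apply/ge0_cvge0P => // e e0.
have /(ge0_cvge0P (fun n => measure_ge0 P _)) S0' := S0.
have e5 : (0 < e / 5)%R by rewrite divr_gt0.
have rho20 : (0 < rho / 2)%R by rewrite divr_gt0.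
have := @evidence_lower_bound _ _ _ _ _ lam mu pit w mw w0 g mg g0 g1 Theta mTheta w_fin w_gt0
  M_fin h mh hE h_liminf dense (rho / 2)%R (e / 5)%R rho20 e5.
have n_large (b c : R) : (0 < c)%R -> \forall n \near \oo, (b <= n%:R * c)%R.
  by move=> c0; near=> n; rewrite -ler_pdivrMr//; near: n; exact: nbhs_infty_ger.
move=> merge; near=> n.
have n0 : (0 < n)%N by near: n; exists 1%N.
have /andP[M0 Moo] := M_fin n0.
have Mfin : M n Theta \is a fin_num by rewrite ge0_fin_numE// ltW.
have m0 : (0 < fine (M n Theta))%R by rewrite fine_gt0// M0.
pose t := (n%:R * rho)%R; pose m := fine (M n Theta).
have te : (expR (- t) <= e / 5)%R.
  rewrite -[leRHS]lnK ?posrE// ler_expR lerNl /t.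
  by near: n; exact: n_large.
have t2 : (expR (- (t / 4)) < 2^-1)%R.
  rewrite expRN ltf_pV2 ?posrE ?expR_gt0//.
  rewrite (lt_le_trans _ (expR_ge1Dx _))// -ltrBlDl ltr_pdivlMr//.
  rewrite (@lt_le_trans _ _ 8%R)//; first by lra.
  by rewrite /t; near: n; exact: n_large.
pose EB := [set: n.-tuple T] `&` [set x | (expR (- t) * m * gn x)%:E < evid (B n) x].
pose EC := ~` S n `&` [set x | (expR (- t) * m * gn x)%:E < evid (C n) x].
pose ED := [set x : n.-tuple T | evid Theta x < (expR (- (n%:R * (rho / 2))) * m * gn x)%:E].
(* Zeros of the true density have probability zero; removing them makes the final comparison
   strict. *)
pose E0 := [set x : n.-tuple T | gn x = 0%R].
have mEB : measurable EB by apply: measurableI => //; exact: mfrac.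
have mEC : measurable EC by apply: measurableI; [exact: (measurableC (mS n))|exact: mfrac].
have mED : measurable ED.
  apply: measurable_set_lte; first exact: measurable_evid.
  by apply/measurable_EFinP; apply: measurable_funM => //; exact: mgn.
have mE0 : measurable E0.
  rewrite -[E0]setTI (_ : E0 = [set x : n.-tuple T | (gn x)%:E = 0]).
    by apply: measurable_eqe => //; apply/measurable_EFinP; exact: mgn.
  by apply/seteqP; split=> x; [move=> /= ->|case].
have pB : law EB <= (e / 5)%:E.
  apply: (@le_trans _ _ (expR (- t))%:E); last by rewrite lee_fin.
  apply: law_markov => //; have := MB n n0; rewrite -[M n Theta in X in X -> _]fineK//.
  rewrite inver gt_eqF// lee_pdivrMr// -EFinM => /le_trans; apply.
  rewrite lee_fin ler_pM2r// ler_expR lerN2 /t mulrCA ler_wpM2l//.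
have pC : law EC <= (e / 5)%:E.
  apply: (@le_trans _ _ (expR (- t))%:E); last by rewrite lee_fin.
  apply: law_markov => //; first exact: (measurableC (mS n)).
  have mlT := measurable_lik_mass lam mw w0 (@measurableT _ (n.-tuple T)).
  have mlS := measurable_lik_mass lam mw w0 (measurableC (mS n)).
  apply: (@le_trans _ _ (\int[mu]_(theta in C n)
      ((expR (- (n%:R * r2)))%:E * lm [set: n.-tuple T] theta))).
    apply: ge0_le_integral => //.
    - by move=> theta _; exact: lik_mass_ge0.
    - by apply: measurable_funS mlS.
    - by apply: measurable_funeM; apply: measurable_funS mlT.
    - move=> theta Ctheta; have := CS n theta n0 Ctheta.
      have q0 := total_mass_gt0 w0 w_fin w_gt0 (CT _ _ Ctheta).
      rewrite /lm (lik_massT mw w0 w_fin) inver gt_eqF ?exprn_gt0//.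
      by rewrite lee_pdivrMr ?exprn_gt0.
  rewrite ge0_integralZl_EFin ?expR_ge0//; last 2 first.
  - by move=> theta _; exact: lik_mass_ge0.
  - by apply: measurable_funS mlT.
  rewrite EFinM; apply: lee_pmul => //.
  - by apply: integral_ge0 => theta _; exact: lik_mass_ge0.
  - by rewrite lee_fin ler_expR lerN2 /t mulrCA ler_wpM2l.
  - rewrite fineK//; apply: ge0_subset_integral => //.
    + by apply: measurable_funS mlT.
    + by move=> theta _; exact: lik_mass_ge0.
have pD : law ED <= (e / 5)%:E by rewrite lawE// /ED /m; near: n; exact: merge.
have p0 : law E0 <= (e / 5)%:E.
  rewrite lawE// integral0_eq ?lee_fin ?ltW// => x.
  by rewrite /E0/= => ->.
have pS : law (S n) <= (e / 5)%:E by near: n; exact: S0'.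
have bad : ~` (sample X n @^-1` good n) `<=`
    sample X n @^-1` (EB `|` S n `|` EC `|` ED `|` E0).
  apply: subsetCl => o /= nbad; set x := sample X n o in nbad *.
  move: nbad; rewrite !not_orP => -[[[[nB nS] nC] nD] n0'].
  have gx0 : (0 < gn x)%R by rewrite lt_neqAle eq_sym gn0 andbT; apply/eqP.
  have eB : evid (B n) x <= (expR (- t) * m * gn x)%:E.
    by rewrite leNgt; apply/negP => hx; apply: nB; split.
  have eC : evid (C n) x <= (expR (- t) * m * gn x)%:E.
    by rewrite leNgt; apply/negP => hx; apply: nC; split.
  have eD : (expR (- (n%:R * (rho / 2))) * m * gn x)%:E <= evid Theta x.
    by rewrite leNgt; apply/negP.
  apply/lte_quotient; rewrite ?expR_gt0//; first exact: evid_le.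
  apply: Or33; apply: (@le_lt_trans _ _ (evid (B n) x + evid (C n) x)).
    by apply: evid_leU => //; exact: ABC.
  apply: (le_lt_trans (leeD eB eC)).
  apply: (@lt_le_trans _ _ ((expR (- (n%:R * (rho / 4))))%:E *
      (expR (- (n%:R * (rho / 2))) * m * gn x)%:E)); last first.
    by rewrite lee_pmul2l// lte_fin expR_gt0.
  rewrite -EFinD -EFinM lte_fin.
  pose u := expR (- (t / 4)).
  have -> : expR (- t) = (u * u * u * u)%R by rewrite -!expRD; congr expR; field.
  have -> : expR (- (n%:R * (rho / 2))) = (u * u)%R.
    by rewrite -!expRD /t; congr expR; field.
  have -> : expR (- (n%:R * (rho / 4))) = u by congr expR; rewrite /t; field.
  have u0 : (0 < u)%R by exact: expR_gt0.
  have mg0 : (0 < m * gn x)%R by rewrite mulr_gt0.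
  rewrite [ltLHS](_ : _ = (u * u * u) * (m * gn x) * (2 * u))%R; last by ring.
  rewrite [ltRHS](_ : _ = (u * u * u) * (m * gn x) * 1)%R; last by ring.
  rewrite ltr_pM2l ?mulr_gt0//.
  by rewrite mulrC -ltr_pdivlMr// div1r.
have mSn := mS n.
apply: (@le_trans _ _ (law (EB `|` S n `|` EC `|` ED `|` E0))).
  apply: le_measure; rewrite ?inE//.
    by apply: measurableC; exact: law_mS.
  by apply: law_mS; do ?apply: measurableU.
rewrite (_ : e = e / 5 + e / 5 + e / 5 + e / 5 + e / 5)%R; last by field.
rewrite !EFinD.
do 4 (apply: (le_trans (law_U _ _)); [by do ?apply: measurableU|by []|apply: leeD => //]).
Unshelve. all: end_near. Qed.

End consistency.

(** * Main result *)

Section trace_sigma_algebra.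
Context {V : pointedType}.
Variables (Theta : set V) (BTheta : set (set V)).
Hypothesis HBsub : forall A, BTheta A -> A `<=` Theta.
Hypothesis HBsigma : sigma_algebra Theta BTheta.

(* [g_sigma_algebraType] generates on the whole carrier, so it also measures
   complements of members of [BTheta]; those inside [Theta] are unchanged. *)
Lemma trace_measurableP (A : set (g_sigma_algebraType BTheta)) :
  BTheta A <-> measurable A /\ A `<=` Theta.
Proof.
split=> [BA|[mA AT]]; first by split; [exact: sub_sigma_algebra|exact: HBsub].
have [B0 BD BU] := HBsigma.
suff : BTheta (A `&` Theta) by rewrite setIidl.
have : sigma_algebra setT [set B | BTheta (B `&` Theta)].
  split=> [|B BB|F BF] /=; first by rewrite set0I.
  - rewrite setTD (_ : _ `&` _ = Theta `\` (B `&` Theta)); first exact: BD.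
    by rewrite setDIr setDv setU0 setIC -setDE.
  - by rewrite setI_bigcupl; exact: BU.
move=> /smallest_sub; apply; last exact: mA.
by move=> B BB /=; rewrite setIidl//; exact: HBsub.
Qed.

End trace_sigma_algebra.

Theorem proposition4p1 (R : realType)
  (dO d : measure_display) (Omega : measurableType dO) (T : measurableType d)
  (P : probability Omega R) (X : nat -> {RV P >-> T})
  (lam : {sigma_finite_measure set T -> \bar R})
  (G : probability T R) (g : T -> R)
  (HXindep : mutually_independent X)
  (HXlaw : forall i (S : set T), measurable S -> distribution P (X i) S = G S)
  (Hg : is_density lam G g)
  (* HBsub is needed because sigma_algebra does not force members of BTheta to
     be subsets of Theta. *)
  (p : nat) (Theta : set 'rV[R]_p) (BTheta : set (set 'rV[R]_p))
  (HBsub : forall A, BTheta A -> A `<=` Theta)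
  (HBsigma : sigma_algebra Theta BTheta)
  (f : g_sigma_algebraType BTheta -> T -> R)
  (Hfmeas : measurable_fun ((Theta : set (g_sigma_algebraType BTheta)) `*` [set: T]) (fun z => f z.1 z.2))
  (Hfge0 : forall theta y, Theta theta -> (0 <= f theta y)%R)
  (Hfint : forall theta, Theta theta -> \int[lam]_y (f theta y)%:E = 1)
  (pi : {measure set (g_sigma_algebraType BTheta) -> \bar R})
  (Hpi : pi Theta <= 1)
  (alpha : R) (Halpha : (0 <= alpha)%R)
  (HM : forall n, (0 < n)%N ->
     0 < Mn lam alpha f pi n setT Theta < +oo)
  (HQ : forall theta, Theta theta -> 0 < Q lam alpha f setT theta < +oo)
  (Hdense : information_dense lam alpha f Theta pi g)
  (A : nat -> set 'rV[R]_p) (HA : forall n, BTheta (A n)) :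
  (exists2 r : R, (0 < r)%R &
     (fun n => P [set w | posterior lam alpha f Theta pi (Theta `\` A n)
                            (sample X n w) < (expR (- (n%:R * r)))%:E])
       @ \oo --> 1)
  <->
  (exists (r1 r2 : R) (B C : nat -> set 'rV[R]_p),
     [/\ (0 < r1)%R, (0 < r2)%R, (forall n, BTheta (B n)) &
         forall n, BTheta (C n)] /\
     [/\ (forall n, (0 < n)%N -> A n `|` B n `|` C n = Theta),
         (forall n, (0 < n)%N ->
            modified_prior lam alpha f Theta pi n (B n)
              <= (expR (- (n%:R * r1)))%:E) &
         exists S : forall n, set (n.-tuple T),
           [/\ (forall n, measurable (S n)),
               (fun n => sample_law X (S n)) @ \oo --> 0 &
               forall n, (0 < n)%N ->
                 ereal_sup [set Qn lam alpha f n (~` S n) theta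
                                / Qn lam alpha f n setT theta
                            | theta in C n]
                 <= (expR (- (n%:R * r2)))%:E]]).
Proof.
have BP := trace_measurableP HBsub HBsigma.
have BTheta_Theta : BTheta Theta.
  by have [B0 BD _] := HBsigma; rewrite -(setD0 Theta); exact: BD.
have mB (B : set (g_sigma_algebraType BTheta)) : BTheta B -> measurable B by move=> /BP[].
have mTheta : measurable (Theta : set (g_sigma_algebraType BTheta)) by exact: mB.
have mAc n : measurable (Theta `\` A n : set (g_sigma_algebraType BTheta)).
  by apply: measurableD => //; exact: mB.
have AcT n : Theta `\` A n `<=` Theta by exact: subDsetl.
have pi_fin : pi Theta < +oo by rewrite (le_lt_trans Hpi)// ltry.
have f0 (theta : g_sigma_algebraType BTheta) y : Theta theta -> (0 <= f theta y)%R.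
  exact: Hfge0.
have HQ' (theta : g_sigma_algebraType BTheta) :
    Theta theta -> 0 < Q lam alpha f setT theta < +oo by exact: HQ.
pose mu := prior mTheta pi_fin.
pose w := exp_score lam alpha f Theta.
have mw := measurable_exp_score mTheta Hfmeas f0 Halpha HQ'.
have w0 theta y : (0 <= w theta y)%R by exact: exp_score_ge0.
have w_fin := exp_score_int_lty f0 Halpha HQ'.
have w_gt0 := exp_score_int_gt0 f0 Halpha HQ'.
have ME n S (B : set (g_sigma_algebraType BTheta)) : B `<=` Theta -> Mn lam alpha f pi n S B =
    \int[mu]_(theta in B) lik_mass lam w S theta.
  by move=> BT; exact: MnE.
have postE n (x : n.-tuple T) : posterior lam alpha f Theta pi (Theta `\` A n) x =
    (\int[mu]_(theta in Theta `\` A n) (lik w theta x)%:E) /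
    (\int[mu]_(theta in Theta) (lik w theta x)%:E).
  exact: posteriorE.
have QnE' n S (theta : g_sigma_algebraType BTheta) : Theta theta ->
    Qn lam alpha f n S theta = lik_mass lam w S theta.
  by move=> Tt; exact: QnE.
have M_fin n : (0 < n)%N ->
    0 < \int[mu]_(theta in Theta) lik_mass lam w [set: n.-tuple T] theta < +oo.
  by move=> n0; rewrite -ME//; exact: HM.
split.
- case=> r r0 Pr.
  (* The rate is halved, as [modified_prior_split] needs the posterior threshold to be the square of
     [rho n]; hence [r1 = r2 = r / 2]. *)
  pose rho n := expR (- (n%:R * (r / 2))).
  have rho0 n : (0 < rho n)%R by exact: expR_gt0.
  have rhoE n : (rho n * rho n = expR (- (n%:R * r)))%R.
    by rewrite -expRD; congr expR; field.
  pose E n := [set x : n.-tuple T |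
    (\int[mu]_(theta in Theta `\` A n) (lik w theta x)%:E) /
    (\int[mu]_(theta in Theta) (lik w theta x)%:E) < (rho n * rho n)%:E].
  have mE n : measurable (E n).
    by apply: measurable_evidence_quotient => //; exact: mulr_gt0.
  pose S n := ~` E n.
  pose B n := (Theta `\` A n) `&` [set theta : g_sigma_algebraType BTheta |
    (rho n)%:E * lik_mass lam w [set: n.-tuple T] theta < lik_mass lam w (~` S n) theta].
  have split_n n : (0 < n)%N -> _ := fun n0 =>
    modified_prior_split mw w0 w_fin mTheta w_gt0 M_fin n0 (rho0 n) (mAc n) (AcT n) (erefl (S n)).
  have BB n : BTheta (B n).
    apply/BP; split; last by move=> theta [[]].
    apply: measurableI; first exact: mAc.
    apply: measurable_set_lte; last first.
      by apply: (measurable_lik_mass lam mw w0); do 2 apply: measurableC; exact: mE.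
    apply: measurable_funeM.
    exact: (measurable_lik_mass lam mw w0 (@measurableT _ (n.-tuple T))).
  have BC n : BTheta ((Theta `\` A n) `\` B n).
    apply/BP; split; last by move=> theta [[]].
    by apply: measurableD => //; exact: mB.
  exists (r / 2)%R, (r / 2)%R, B, (fun n => (Theta `\` A n) `\` B n).
  have r20 : (0 < r / 2)%R by rewrite divr_gt0.
  split; first by split.
  split.
  + move=> n n0; apply/seteqP; split=> theta.
      by case=> [[|[[]]]|[[]]] //; exact: HBsub.
    move=> Tt; have [At|nAt] := pselect (A n theta); first by left; left.
    by have [Bt|nBt] := pselect (B n theta); [left; right|right].
  + move=> n n0; rewrite /modified_prior !ME//; last by move=> theta [[]].
    exact: (split_n n n0).1.
  + exists S; split.
    * by move=> n; apply: measurableC; exact: mE.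
    * have mEs n : measurable (sample X n @^-1` E n).
        rewrite -[X in measurable X]setTI.
        exact: (@measurable_sample _ _ _ _ _ P X n measurableT _ (mE n)).
      have [+ _] := @probability_setC_cvg0 _ _ _ P _ mEs.
      rewrite /sample_law /S /pushforward; apply.
      apply: cvg_trans Pr; apply: near_eq_cvg; near=> n.
      congr (P _); apply/seteqP; split=> o /=;
      by rewrite /E /= postE rhoE.
    * move=> n n0; apply: ge_ereal_sup => _ [theta [Tt nB] <-].
      by rewrite !QnE'; [exact: (split_n n n0).2|exact: (AcT _ _ Tt)..].
- case=> r1 [r2] [B] [C] [[r10 r20 BB BC] [ABC MB [S [mS S0 CS]]]].
  case: Hdense => pit [[h [hder h_liminf]] dense].
  have BT n : B n `<=` Theta by exact: HBsub.
  have CT n : C n `<=` Theta by exact: HBsub.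
  have mh n : (0 < n)%N -> measurable_fun (Theta : set (g_sigma_algebraType BTheta)) (h n).
    by move=> /hder[].
  have hE n (V : set (g_sigma_algebraType BTheta)) : (0 < n)%N -> measurable V -> V `<=` Theta ->
      (\int[mu]_(theta in V) lik_mass lam w [set: n.-tuple T] theta) /
      (\int[mu]_(theta in Theta) lik_mass lam w [set: n.-tuple T] theta) =
      \int[pit]_(theta in V) h n theta.
    by move=> /hder[_ _ hn] mV VT; rewrite -hn// /modified_prior !ME.
  have [mg g0 gG] := Hg.
  have g1 : \int[lam]_y (g y)%:E = 1.
    by rewrite -gG//; exact: probability_setT.
  (* Rewrites the neighbourhoods in the definition of information density in terms of [klgap], the
     form used by the evidence bound. *)
  have KLDE (theta : g_sigma_algebraType BTheta) : Theta theta ->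
      KLD lam (EFin \o g) (modified_density lam alpha f theta) =
      \int[lam]_y klgap (g y) (normalized lam w theta y).
    move=> Tt; rewrite (modified_densityE f0 Halpha HQ')// KLD_klgap//.
    - exact: (measurableT_comp (measurable_normalized mw w0 w_fin) (pair1_measurable theta)).
    - exact: normalized_ge0.
    - exact: (integral_normalized mw w0 w_fin w_gt0 Tt).
  have dense' e : (0 < e)%R -> 0 < pit ((Theta : set (g_sigma_algebraType BTheta)) `&`
     [set theta | \int[lam]_y klgap (g y) (normalized lam w theta y) < e%:E]).
    move=> /dense; congr (_ < pit _).
    by apply/seteqP; split=> theta /= [Tt]; rewrite KLDE.
  have [||||||||||r r0 Pr] := posterior_exponentially_small HXindep HXlaw
    Hg mw w0 w_fin mTheta w_gt0
    M_fin mh hE h_liminf dense' (A := fun n => Theta `\` A n) (B := B) (C := C)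
    (S := S) r10 r20.
  - exact: mAc.
  - exact: AcT.
  - by move=> n; exact: mB.
  - by move=> n; exact: mB.
  - exact: CT.
  - move=> n n0 theta [Tt nA]; have : (A n `|` B n `|` C n) theta by rewrite ABC.
    by case=> [[//|Bt]|Ct]; [left|right].
  - by move=> n n0; rewrite -!ME//; exact: MB.
  - exact: mS.
  - exact: S0.
  - move=> n theta n0 Ct; apply: le_trans (CS n n0).
    apply: ereal_sup_ubound.
    by exists theta => //; rewrite !QnE'//; exact: (CT n _ Ct).
  exists r => //.
  rewrite (_ : (fun n => _) = (fun n => P [set o |
    (\int[mu]_(theta in Theta `\` A n) (lik w theta (sample X n o))%:E) /
    (\int[mu]_(theta in Theta) (lik w theta (sample X n o))%:E)
      < (expR (- (n%:R * r)))%:E])); first exact: Pr.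
  by apply/funext => n; congr (P _); apply/seteqP; split=> o /=; rewrite postE.
Unshelve. all: end_near.
Qed.
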